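(* Let $R>0$, let $\nu>\frac{1}{2R^2}$, let $m$ be an integer with $0\le m\le \lfloor \nu R^2-\frac12\rfloor$, let $z\in\mathbb{C}$ with $|z|<R$, and put $\tau=|z|^2/R^2$. Let $(p_j^{(\nu,z,m,R)})_{j\ge 0}$ be the generalized negative binomial distribution of parameters $(\nu,z,m,R)$. Then for every complex number $\xi$ with $|\xi|<1$, its moment generating function $G^{(\nu,\tau,m,R)}(\xi):=\sum_{j=0}^{\infty}\xi^j p_j^{(\nu,z,m,R)}$ is given by $$G^{(\nu,\tau,m,R)}(\xi)=\left(\frac{1-\tau}{1-\tau\xi}\right)^{2\nu R^2}\left(\frac{(\tau-\xi)(1-\tau\xi)}{(1-\tau)^2}\right)^{m}P_m^{(2\nu R^2-2m-1,\,0)}\left(1+\frac{2\xi(1-\tau)^2}{(\tau-\xi)(1-\tau\xi)}\right).$$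
   Context: Jacobi polynomials: for real $a,b>-1$ and integer $n\ge0$, $P_n^{(a,b)}(x)=\sum_{k=0}^n\binom{n+a}{k}\binom{n+b}{n-k}\left(\frac{x-1}{2}\right)^{n-k}\left(\frac{x+1}{2}\right)^k$, where $\binom{c}{k}=\frac{c(c-1)\cdots(c-k+1)}{k!}$ for real $c$. Generalized negative binomial distribution (GNBD) of parameters $(\nu,z,m,R)$: with $\tau=|z|^2/R^2\in[0,1)$, for integers $j\ge0$, $$p_j^{(\nu,z,m,R)}:=\gamma_j^{(\nu,m,R)}(1-\tau)^{2\nu R^2-2m}\,\tau^{|m-j|}\left(P_{\min(m,j)}^{(|m-j|,\,2\nu R^2-2m-1)}(1-2\tau)\right)^2,$$ where $$\gamma_j^{(\nu,m,R)}=\frac{j!\,\Gamma(2\nu R^2-m)}{m!\,\Gamma(2\nu R^2-2m+j)}\ \text{ if } j\le m,\qquad \gamma_j^{(\nu,m,R)}=\frac{m!\,\Gamma(2\nu R^2-2m+j)}{j!\,\Gamma(2\nu R^2-m)}\ \text{ if } j\ge m,$$ and $0^0=1$. Conventions: the power with exponent $2\nu R^2$ is the principal branch. The product of the $m$-th power and the Jacobi polynomial on the right-hand side is a polynomial expression in $\xi$; at $\xi=\tau$, where the argument of the Jacobi polynomial is formally singular, it is understood as the value of this polynomial (i.e. by continuity). *)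

(* Defs.v *)
From HB Require Import structures.
From mathcomp Require Import all_boot all_order all_algebra.
From mathcomp Require Import all_classical all_reals all_analysis.
From mathcomp Require Import complex.

Set Implicit Arguments.
Unset Strict Implicit.
Unset Printing Implicit Defensive.

Import Order.TTheory GRing.Theory Num.Theory.
Import numFieldNormedType.Exports.
Import ComplexField.Normc.

Local Open Scope classical_set_scope.
Local Open Scope ring_scope.
Local Open Scope complex_scope.

(* The usual topology of the complex plane: the one of the normed field K[i],
   which is not attached to K[i] by default. *)
HB.instance Definition _ (K : realType) := NormedModule.copy K[i] K[i]^o.

(* Euler's integral; meaningful for 0 < x, the only case used. *)
Definition Gamma (K : realType) (x : K) : K :=
  \int[lebesgue_measure]_(t in `]0, +oo[) (t `^ (x - 1) * expR (- t)).

Definition gbinom (F : numFieldType) (c : F) (k : nat) : F :=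
  (\prod_(i < k) (c - i%:R)) / k`!%:R.

Definition jacobi (F : numFieldType) (n : nat) (a b x : F) : F :=
  \sum_(k < n.+1) gbinom (n%:R + a) k * gbinom (n%:R + b) (n - k)
                  * ((x - 1) / 2) ^+ (n - k) * ((x + 1) / 2) ^+ k.

Definition cexp (K : realType) (w : K[i]) : K[i] :=
  let: x +i* y := w in (expR x * cos y) +i* (expR x * sin y).

(* Principal argument, with values in ]-pi, pi] when w != 0. *)
Definition carg (K : realType) (w : K[i]) : K :=
  let: x +i* y := w in
  if 0 <= y then acos (x / normc w) else - acos (x / normc w).

Definition clog (K : realType) (w : K[i]) : K[i] := ln (normc w) +i* carg w.

(* Principal branch of the power w ^ s, for w != 0. *)
Definition cpow (K : realType) (w s : K[i]) : K[i] := cexp (s * clog w).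

Definition gnbd_coef (K : realType) (nu : K) (m : nat) (R : K) (j : nat) : K :=
  let B := 2 * nu * R ^+ 2 in
  if (j <= m)%N
  then j`!%:R * Gamma (B - m%:R) / (m`!%:R * Gamma (B - 2 * m%:R + j%:R))
  else m`!%:R * Gamma (B - 2 * m%:R + j%:R) / (j`!%:R * Gamma (B - m%:R)).

(* The power of tau has a natural number exponent, so that 0 ^+ 0 = 1. *)
Definition gnbd (K : realType) (nu : K) (z : K[i]) (m : nat) (R : K) (j : nat)
    : K :=
  let B := 2 * nu * R ^+ 2 in
  let tau := normc z ^+ 2 / R ^+ 2 in
  let d := `|m%:Z - j%:Z|%N in
  gnbd_coef nu m R j * (1 - tau) `^ (B - 2 * m%:R) * tau ^+ d
  * jacobi (minn m j) d%:R (B - 2 * m%:R - 1) (1 - 2 * tau) ^+ 2.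

(* Main.v *)
Require Import Defs.
From HB Require Import structures.
From mathcomp Require Import all_boot all_order all_algebra.
From mathcomp Require Import all_classical all_reals all_analysis.
From mathcomp Require Import measurable_realfun complex ring lra zify.

Import Order.TTheory GRing.Theory Num.Theory.
Import numFieldNormedType.Exports.
Import ComplexField.Normc.

Set Implicit Arguments.
Unset Strict Implicit.
Unset Printing Implicit Defensive.

Local Open Scope classical_set_scope.
Local Open Scope ring_scope.
Local Open Scope complex_scope.

(** Put b = 2 nu R^2 - 2 m, so that b >= 1, and y = tau xi.  For j >= m the
    distribution contains the square of A_j, the Jacobi polynomial of degree m
    with parameters (j - m, b - 1) at 1 - 2 tau.  The explicit sum for A_j also
    makes sense for j < m, where it is a multiple of the Jacobi polynomial of
    degree j with parameters (m - j, b - 1); as a function of j it is a Meixner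
    polynomial ([meixner]).  With Gamma (x + 1) = x Gamma x, both cases of the
    definition become the same expression: up to a factor independent of j,
    p_j is (b)_j / j! tau^j A_j^2 ([gnbd_meixner]).  The generating function is
    therefore a multiple of

      S = sum_j (b)_j / j! y^j A_j^2.

    Summing the series.  As A_j^2 is a polynomial in j, it is a combination of
    the binomials C(j, i) with i <= 2 m, and

      sum_j (b)_j / j! y^j C(j, i) = (b)_i / i! y^i (1 - y)^(- b - i)

    is a shifted binomial series.  So S = (1 - y)^(- b - 2 m) P(b), where P is
    the finite triple sum [linearized_sum], a polynomial in b.

    Finding P.  It is enough to know P at b = - N for all large integers N.
    There the series are finite, A_j is up to sign the coefficient of s^m in
    (1 - s)^j (1 - tau s)^(N - j), and S is the coefficient of s^m t^m in

      ((1 - tau s)(1 - tau t) - y (1 - s)(1 - t))^N.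

    Multiplied by 1 - y, the base of this power is w(s) w(t) - y (1 - tau)^2 s t
    with w(s) = (1 - y) - (tau - y) s ([kernel_factor]).  Expanding by the
    binomial theorem gives P = [diag_sum], a sum of m + 1 terms
    ([linearized_sumE]).

    Recognising the Jacobi polynomial.  If D = (tau - xi)(1 - tau xi) and
    1 + 2 W is the argument on the right-hand side, then
    W = xi (1 - tau)^2 / D and 1 + W = tau (1 - xi)^2 / D, so D^m times the
    Jacobi polynomial is a polynomial in xi, and term by term it is proportional to
    [diag_sum] ([jacobi_factorE], [diag_sum_jacobi_factor]).

    The binomial series itself ([cvg_negbinom_series]) is proved on the ray
    from 0 to w: the series at t w times (1 - t w)^b has zero derivative in t.
    At tau = 0, where these formulas cannot be divided by tau^m, the
    distribution is the point mass at m. *)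

(** * An identity for squares of Meixner polynomials *)

Definition poch (F : numFieldType) (b : F) (n : nat) : F :=
  \prod_(i < n) (b + i%:R).

(** The coefficient of x^n in (1 - x)^(- b). *)
Definition negbinom (F : numFieldType) (b : F) (n : nat) : F :=
  poch b n / n`!%:R.

Lemma fact_neq0 (F : numFieldType) n : (n`!%:R : F) != 0.
Proof. by rewrite pnatr_eq0 -lt0n fact_gt0. Qed.

Lemma poch0 (F : numFieldType) (b : F) : poch b 0 = 1.
Proof. by rewrite /poch big_ord0. Qed.

Lemma pochS (F : numFieldType) (b : F) n : poch b n.+1 = poch b n * (b + n%:R).
Proof. by rewrite /poch big_ord_recr. Qed.

Lemma pochD (F : numFieldType) (b : F) m n :
  poch b (m + n) = poch b m * poch (b + m%:R) n.
Proof.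
elim: n => [|n IH]; first by rewrite addn0 poch0 mulr1.
by rewrite addnS !pochS IH natrD addrA mulrA.
Qed.

Lemma poch_gt0 (F : numFieldType) (b : F) n : 0 < b -> 0 < poch b n.
Proof. by move=> b0; apply: prodr_gt0 => i _; rewrite ltr_pwDl. Qed.

Lemma negbinom0 (F : numFieldType) (b : F) : negbinom b 0 = 1.
Proof. by rewrite /negbinom poch0 fact0 divr1. Qed.

Lemma natr_bin (F : numFieldType) n k : (k <= n)%N ->
  'C(n, k)%:R = n`!%:R / (k`!%:R * (n - k)`!%:R) :> F.
Proof.
by move=> kn; rewrite -natrM -(bin_fact kn) natrM mulfK // natrM mulf_neq0 // fact_neq0.
Qed.

(** Taking j = i + n, this turns the series of [negbinom b j] y^j C(j, i) into a
    multiple of the binomial series with exponent b + i. *)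
Lemma negbinom_shift (F : numFieldType) (b : F) i n :
  negbinom b (i + n) * 'C(i + n, i)%:R =
  negbinom b i * negbinom (b + i%:R) n.
Proof.
rewrite natr_bin ?leq_addr // addKn /negbinom pochD; field.
by rewrite !fact_neq0.
Qed.

Lemma gbinom_negbinom (F : numFieldType) (b : F) m k : (k <= m)%N ->
  gbinom (m%:R + (b - 1)) (m - k) = negbinom (b + k%:R) (m - k).
Proof.
move=> km; rewrite /gbinom /negbinom /poch; congr (_ / _).
rewrite [RHS](reindex_inj rev_ord_inj) /=; apply: eq_bigr => i _.
by rewrite natrB ?natrB // -natr1; ring.
Qed.

Lemma gbinom_nat (F : numFieldType) (n k : nat) : (k <= n)%N ->
  gbinom (n%:R : F) k = 'C(n, k)%:R.
Proof.
move=> kn; rewrite /gbinom; apply: (canLR (mulfK (fact_neq0 F k))).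
rewrite -natrM bin_ffact ffact_prod natr_prod; apply: eq_bigr => i _.
by rewrite natrB // ltnW // (leq_trans (ltn_ord i)).
Qed.

Lemma negbinomN (F : numFieldType) (N k : nat) : (k <= N)%N ->
  negbinom (- N%:R : F) k = (-1) ^+ k * 'C(N, k)%:R.
Proof.
move=> kN; rewrite -gbinom_nat // /negbinom /gbinom mulrA; congr (_ / _).
have -> : (-1) ^+ k = \prod_(i < k) (-1) :> F by rewrite prodr_const card_ord.
rewrite /poch -big_split /=.
by apply: eq_bigr => i _; ring.
Qed.

(** For j >= m this is the Jacobi polynomial of degree m with parameters
    (j - m, b - 1) at 1 - 2 tau.  The formula has a meaning for every j, and for
    every b, in particular for negative integers. *)
Definition meixner (F : numFieldType) (m : nat) (b tau : F) (j : nat) : F :=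
  \sum_(k < m.+1) 'C(j, k)%:R * negbinom (b + k%:R) (m - k)
     * (- tau) ^+ (m - k) * (1 - tau) ^+ k.

Lemma sum_ord_pad (V : nmodType) n p (G : nat -> V) :
  \sum_(k < n.+1) G k = \sum_(k < (n + p).+1) if (k <= n)%N then G k else 0.
Proof.
rewrite -(big_mkord xpredT G) (big_nat_widen _ _ (n + p).+1) ?ltnS ?leq_addr //.
by rewrite big_mkcond big_mkord.
Qed.

Lemma coef_affine_exp (F : numFieldType) (a b : F) (n i : nat) :
  ((a%:P - b *: 'X) ^+ n)`_i = 'C(n, i)%:R * a ^+ (n - i) * (- b) ^+ i.
Proof.
rewrite exprDn coef_sum.
transitivity (\sum_(k < n.+1 | k == i :> nat)
   'C(n, i)%:R * a ^+ (n - i) * (- b) ^+ i : F).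
  rewrite [RHS]big_mkcond /=; apply: eq_bigr => k _.
  rewrite -polyC_exp -scaleNr exprZn coefMn coefCM coefZ coefXn eq_sym.
  case: eqP => [->|_]; last by rewrite mulr0 mulr0 mul0rn.
  by rewrite mulr1 -mulrA mulr_natl.
case: (ltnP i n.+1) => [ilt|ige].
  rewrite (bigD1 (Ordinal ilt)) //= big1 ?addr0 // => k /andP[/eqP ki /eqP[]].
  exact: val_inj.
by rewrite big1 ?bin_small ?mul0r // => k /eqP.
Qed.

(** Write 1 - s = (1 - tau s) - (1 - tau) s and expand the j-th power: the
    negative binomials at - N + k are binomials C(N - k, m - k) up to sign. *)
Lemma meixnerN (F : numFieldType) (m N j : nat) (tau : F) :
  (j <= N)%N -> (m <= N)%N ->
  meixner m (- N%:R) tau j =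
  (-1) ^+ m * ((1 - 'X) ^+ j * (1 - tau *: 'X) ^+ (N - j))`_m.
Proof.
move=> jN mN.
have -> : (1 - 'X : {poly F}) = (1 - tau *: 'X) - (1 - tau) *: 'X.
  by rewrite scalerBl scale1r; ring.
rewrite exprBn mulr_suml coef_sum mulr_sumr.
pose G (k : nat) : F := 'C(j, k)%:R * negbinom (- N%:R + k%:R) (m - k)
     * (- tau) ^+ (m - k) * (1 - tau) ^+ k.
rewrite /meixner (sum_ord_pad _ j G) addnC.
rewrite (sum_ord_pad _ m (fun k => (-1) ^+ m * ((-1) ^+ k *
     (1 - tau *: 'X) ^+ (j - k) * ((1 - tau) *: 'X) ^+ k *+ 'C(j, k) *
      (1 - tau *: 'X) ^+ (N - j))`_m)).
apply: eq_bigr => k _; case: (leqP k j) => kj; last first.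
  by case: ifP => // _; rewrite /G bin_small // !mul0r.
rewrite exprZn mulrnAl coefMn.
have -> : (-1) ^+ k * (1 - tau *: 'X) ^+ (j - k) * ((1 - tau) ^+ k *: 'X^k)
   * (1 - tau *: 'X) ^+ (N - j)
   = (- (1 - tau)) ^+ k *: ((1 - tau *: 'X) ^+ (N - k) * 'X^k).
  have -> : (N - k = (j - k) + (N - j))%N by lia.
  rewrite exprD [(- (1 - tau)) ^+ k]exprNn -!mul_polyC polyCM
     (polyC_exp k (-1)%R) polyCN polyC1.
  ring.
rewrite coefZ coefMXn ltnNge; case: (leqP k m) => km /=; last first.
  by rewrite mulr0 mul0rn mulr0.
rewrite -polyC1 coef_affine_exp expr1n /G.
have -> : - N%:R + k%:R = - (N - k)%:R :> F by rewrite natrB ?(leq_trans km) //; ring.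
rewrite negbinomN ?leq_sub2r //.
rewrite [(- (1 - tau)) ^+ k]exprNn -[in (-1) ^+ m](subnK km) exprD.
have : (-1) ^+ k * (-1) ^+ k = 1 :> F by rewrite -expr2 sqrr_sign.
set e := (-1) ^+ k => ee.
by transitivity ('C(j, k)%:R * ((-1) ^+ (m - k) * 'C(N - k, m - k)%:R)
  * (- tau) ^+ (m - k) * (1 - tau) ^+ k * (e * e)); [rewrite ee mulr1 | ring].
Qed.

(** For b = - N, up to a power of 1 - y, the coefficient of s^m t^m in
    ((1 - tau s)(1 - tau t) - y (1 - s)(1 - t))^N; see [meixner_diagN]. *)
Definition diag_sum (F : numFieldType) (m : nat) (b tau y : F) : F :=
  \sum_(l < m.+1) negbinom b l * negbinom (b + l%:R) (m - l) ^+ 2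
     * (y * (1 - tau) ^+ 2) ^+ l * (tau - y) ^+ (2 * (m - l)).

(** In bivariate polynomials, p(s) q(t) is encoded as [p ^:P * q%:P]: the outer
    variable is s, and t is the inner one. *)
Lemma diag_coef_prod (F : numFieldType) (m : nat) (p q : {poly F}) (c : F) :
  ((c%:P%:P * (p ^:P * q%:P))`_m)`_m = c * (p`_m * q`_m).
Proof. by rewrite coefCM coefMC coef_map !coefCM. Qed.

(** The base of the N-th power, a bilinear form in (1, s) and (1, t), is diagonalised
    by completing the product: what remains is a multiple of s t, whose powers do
    not mix the degrees in s and t. *)
Lemma kernel_factor (F : numFieldType) (tau y : F) :
  let u : {poly F} := 1 - tau *: 'X in
  let v : {poly F} := 1 - 'X in
  let w : {poly F} := (1 - y)%:P - (tau - y) *: 'X in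
  (1 - y)%:P%:P * (u ^:P * u%:P - y%:P%:P * (v ^:P * v%:P)) =
  w ^:P * w%:P - (y * (1 - tau) ^+ 2)%:P%:P * ('X ^:P * 'X%:P).
Proof.
move=> u v w; rewrite /u /v /w -!mul_polyC !rmorphB !rmorphM /= !map_polyC map_polyX.
rewrite /= !rmorphB /= !map_polyC /= ?rmorphB ?polyC1 /= ?polyC1.
ring.
Qed.

Lemma tensor_binom_term (F : numFieldType) (c : F) (p q : {poly F}) n k C :
  (-1) ^+ k * (p ^:P * p%:P) ^+ n * (c%:P%:P * (q ^:P * q%:P)) ^+ k *+ C =
  ((-1) ^+ k * c ^+ k * C%:R)%:P%:P *
  ((p ^+ n * q ^+ k) ^:P * (p ^+ n * q ^+ k)%:P).
Proof.
rewrite !exprMn !rmorphM /= !rmorphXn /= !rmorphN /= !rmorph1 !rmorph_nat /=.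
ring.
Qed.

(** Both sides are the coefficient of s^m t^m in the same N-th power, expanded
    once as it stands and once through [kernel_factor]. *)
Lemma meixner_diagN (F : numFieldType) (m N : nat) (tau y : F) :
  (2 * m <= N)%N -> 1 - y != 0 ->
  \sum_(j < N.+1) negbinom (- N%:R) j * y ^+ j * meixner m (- N%:R) tau j ^+ 2
  = (1 - y) ^+ (N - 2 * m) * diag_sum m (- N%:R) tau y.
Proof.
move=> mN y1; have mN' : (m <= N)%N by lia.
pose u : {poly F} := 1 - tau *: 'X; pose v : {poly F} := 1 - 'X.
pose w : {poly F} := (1 - y)%:P - (tau - y) *: 'X.
pose D := y * (1 - tau) ^+ 2.
pose E := (u ^:P * u%:P - y%:P%:P * (v ^:P * v%:P)) ^+ N.
have LE : (E`_m)`_m =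
  \sum_(j < N.+1) negbinom (- N%:R) j * y ^+ j * meixner m (- N%:R) tau j ^+ 2.
  rewrite /E exprBn !coef_sum; apply: eq_bigr => j _.
  have jN : (j <= N)%N by rewrite -ltnS.
  rewrite tensor_binom_term [u ^+ _ * _]mulrC.
  rewrite diag_coef_prod negbinomN // meixnerN // exprMn sqrr_sign mul1r -/u -/v.
  ring.
(* The factor (1 - y)^N is absorbed in the N-th power to use the factorisation. *)
have RE : (1 - y) ^+ N * (E`_m)`_m =
    (1 - y) ^+ (2 * (N - m)) * diag_sum m (- N%:R) tau y.
  transitivity ((((1 - y)%:P%:P ^+ N * E)`_m)`_m).
    by rewrite -!rmorphXn /= !coefCM.
  rewrite /E -exprMn kernel_factor exprBn !coef_sum.
  rewrite /diag_sum mulr_sumr.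
  have -> : N.+1 = (m + (N - m)).+1 by lia.
  rewrite [RHS](sum_ord_pad _ (N - m) (fun l => (1 - y) ^+ (2 * (N - m)) *
    (negbinom (- N%:R) l * negbinom (- N%:R + l%:R) (m - l) ^+ 2
     * (y * (1 - tau) ^+ 2) ^+ l * (tau - y) ^+ (2 * (m - l))))).
  apply: eq_bigr => l _; rewrite -/w -/D.
  have lN : (l <= N)%N by have := ltn_ord l; lia.
  rewrite tensor_binom_term.
  rewrite diag_coef_prod coefMXn ltnNge; case: (leqP l m) => lm /=; last first.
    by rewrite !mulr0.
  rewrite /w coef_affine_exp.
  have -> : - N%:R + l%:R = - (N - l)%:R :> F by rewrite natrB //; ring.
  rewrite !negbinomN ?leq_sub2r // ![(2 * _)%N]mulnC !exprM.
  have -> : (N - l - (m - l) = N - m)%N by lia.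
  rewrite [(- (tau - y)) ^+ _]exprNn -/D; ring.
rewrite -LE; apply: (mulfI (expf_neq0 N y1)); rewrite RE mulrA -exprD.
by congr (_ ^+ _ * _); lia.
Qed.

(** C(j, l + r) C(l + r, k) = C(j, k) C(j - k, l + r - k), after which the sum over
    r is Vandermonde's convolution for C(k + (j - k), l). *)
Lemma binM_linearize (j k l : nat) :
  ('C(j, k) * 'C(j, l) =
   \sum_(r < k.+1) 'C(l + r, k) * 'C(k, r) * 'C(j, l + r))%N.
Proof.
have E (i : nat) : ('C(j, i) * 'C(i, k) =
    'C(j, k) * if (k <= i)%N then 'C(j - k, i - k) else 0)%N.
  case: (leqP k i) => [ki|ik]; last by rewrite [X in (_ * X)%N]bin_small // !muln0.
  case: (leqP i j) => [ij|ji]; last first.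
    rewrite (bin_small ji) mul0n.
    case: (leqP k j) => kj; last by rewrite bin_small.
    by rewrite [X in (_ * X)%N]bin_small ?muln0 // ltn_sub2r // (leq_ltn_trans kj).
  have f1 := bin_fact ij; have f2 := bin_fact ki.
  have f3 := bin_fact (leq_trans ki ij).
  have f4 := bin_fact (leq_sub2r k ij).
  have ee : (j - k - (i - k) = j - i)%N by lia.
  rewrite ee in f4.
  have p : (0 < k`! * (i - k)`! * (j - i)`!)%N by rewrite !muln_gt0 !fact_gt0.
  apply/eqP; rewrite -(eqn_pmul2r p); apply/eqP.
  transitivity j`!.
    by rewrite -f1 -f2; lia.
  by rewrite -f3 -f4; lia.
have F (r : nat) : ('C(l + r, k) * 'C(k, r) * 'C(j, l + r) =
  'C(j, k) * ('C(k, r) * if (k <= l + r)%N then 'C(j - k, l + r - k) else 0))%N.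
  by rewrite mulnAC mulnC [('C(l + r, k) * _)%N]mulnC E; lia.
under eq_bigr do rewrite F.
rewrite -big_distrr /=; case: (leqP k j) => kj; last by rewrite bin_small.
congr (_ * _)%N.
rewrite -{1}(subnKC kj) -binomial.Vandermonde.
pose G r := ('C(k, r) * if (r <= l)%N then 'C(j - k, l - r) else 0)%N.
transitivity (\sum_(0 <= r < (l + k).+1) G r)%N.
  rewrite -(big_mkord xpredT (fun i => 'C(k, i) * 'C(j - k, l - i))%N).
  rewrite (big_nat_widen _ _ (l + k).+1) ?ltnS ?leq_addr // big_mkcond /=.
  by apply: eq_bigr => r _; rewrite /G ltnS; case: ifP; rewrite ?muln0.
transitivity (\sum_(0 <= r < k.+1) G r)%N.
  rewrite [RHS](big_nat_widen _ _ (l + k).+1) ?ltnS ?leq_addl // big_mkcond /=.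
  rewrite [RHS]big_mkcond.
  apply: eq_bigr => r _; rewrite /G ltnS; case: (leqP r k) => //= rk.
  by rewrite bin_small.
rewrite big_mkord (reindex_inj rev_ord_inj) /=; apply: eq_bigr => r _.
have rk : (r <= k)%N by rewrite -ltnS.
rewrite /G subSS bin_sub //; congr (_ * _)%N.
have -> : (k - r <= l)%N = (k <= l + r)%N by lia.
by case: ifP => // _; congr 'C(_, _); lia.
Qed.

Definition meixner_coef (F : numFieldType) (m : nat) (b tau : F) (k : nat) : F :=
  negbinom (b + k%:R) (m - k) * (- tau) ^+ (m - k) * (1 - tau) ^+ k.

Lemma meixner_sqr (F : numFieldType) (m : nat) (b tau : F) (j : nat) :
  meixner m b tau j ^+ 2 =
  \sum_(k < m.+1) \sum_(l < m.+1) \sum_(r < k.+1)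
    meixner_coef m b tau k * meixner_coef m b tau l *
    ('C(l + r, k) * 'C(k, r))%:R * 'C(j, l + r)%:R.
Proof.
rewrite expr2 /meixner mulr_suml; apply: eq_bigr => k _.
rewrite mulr_sumr; apply: eq_bigr => l _.
transitivity (meixner_coef m b tau k * meixner_coef m b tau l *
   ('C(j, k) * 'C(j, l))%:R); first by rewrite /meixner_coef natrM; ring.
rewrite binM_linearize natr_sum mulr_sumr; apply: eq_bigr => r _.
by rewrite !natrM !mulrA.
Qed.

(** What remains of the sum over j of [negbinom b j] y^j A_j^2, multiplied by
    (1 - y)^(b + 2 m), once A_j^2 is expanded by [meixner_sqr] and every series
    is summed. *)
Definition linearized_sum (F : numFieldType) (m : nat) (b tau y : F) : F :=
  \sum_(k < m.+1) \sum_(l < m.+1) \sum_(r < k.+1)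
    meixner_coef m b tau k * meixner_coef m b tau l *
    ('C(l + r, k) * 'C(k, r))%:R *
    (negbinom b (l + r) * y ^+ (l + r) * (1 - y) ^+ (2 * m - (l + r))).

Lemma negbinom_sumN (F : numFieldType) (N i : nat) (y : F) : (i <= N)%N ->
  \sum_(j < N.+1) negbinom (- N%:R) j * y ^+ j * 'C(j, i)%:R =
  negbinom (- N%:R) i * y ^+ i * (1 - y) ^+ (N - i).
Proof.
move=> iN.
rewrite -(big_mkord xpredT (fun j => negbinom (- N%:R) j * y ^+ j * 'C(j, i)%:R)).
rewrite (big_cat_nat _ (n := i)) //=; last exact: leqW.
rewrite big_nat_cond big1 ?add0r; last first.
  by move=> j /andP[/andP[_ ji] _]; rewrite bin_small // mulr0.
rewrite -{1}(add0n i) big_addn big_mkord.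
rewrite exprBn mulr_sumr subSn //; apply: eq_bigr => n _.
have nN : (n <= N - i)%N by rewrite -ltnS.
transitivity (negbinom (- N%:R) (i + n) * 'C(i + n, i)%:R * y ^+ i * y ^+ n).
  by rewrite addnC exprD; ring.
rewrite negbinom_shift.
have -> : - N%:R + i%:R = - (N - i)%:R :> F by rewrite natrB //; ring.
by rewrite [negbinom _ n]negbinomN // expr1n; ring.
Qed.

Lemma linearized_sumN (F : numFieldType) (m N : nat) (tau y : F) :
  (2 * m <= N)%N -> 1 - y != 0 ->
  linearized_sum m (- N%:R) tau y = diag_sum m (- N%:R) tau y.
Proof.
move=> mN y1; apply: (mulfI (expf_neq0 (N - 2 * m) y1)).
rewrite -meixner_diagN //.
under [RHS]eq_bigr do rewrite meixner_sqr mulr_sumr.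
rewrite /linearized_sum mulr_sumr exchange_big /=; apply: eq_bigr => k _.
under [RHS]eq_bigr do rewrite mulr_sumr.
rewrite mulr_sumr exchange_big /=; apply: eq_bigr => l _.
under [RHS]eq_bigr do rewrite mulr_sumr.
rewrite mulr_sumr exchange_big /=; apply: eq_bigr => r _.
set c := meixner_coef _ _ _ _ * _ * _.
have lr : (l + r <= 2 * m)%N.
  by have := ltn_ord l; have := ltn_ord r; have := ltn_ord k; lia.
transitivity (c * (negbinom (- N%:R) (l + r) * y ^+ (l + r)
                   * (1 - y) ^+ (N - (l + r)))).
  have -> : (N - (l + r) = (N - 2 * m) + (2 * m - (l + r)))%N by lia.
  by rewrite [(1 - y) ^+ (_ + _)]exprD; ring.
rewrite -negbinom_sumN ?(leq_trans lr) // mulr_sumr; apply: eq_bigr => j _; ring.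
Qed.

Definition polynomial_fun (F : numFieldType) (f : F -> F) :=
  exists p : {poly F}, forall x, f x = p.[x].

Lemma polynomial_fun_cst (F : numFieldType) (c : F) : polynomial_fun (fun=> c).
Proof. by exists c%:P => x; rewrite hornerC. Qed.

Lemma polynomial_funM (F : numFieldType) (f g : F -> F) :
  polynomial_fun f -> polynomial_fun g -> polynomial_fun (fun x => f x * g x).
Proof. by move=> [p fp] [q gq]; exists (p * q) => x; rewrite hornerM fp gq. Qed.

Lemma polynomial_fun_sum (F : numFieldType) (I : Type) (r : seq I) (f : I -> F -> F) :
  (forall i, polynomial_fun (f i)) -> polynomial_fun (fun x => \sum_(i <- r) f i x).
Proof.
move=> fP; elim: r => [|i r [p IH]].
  by exists 0 => x; rewrite big_nil horner0.
by have [q fq] := fP i; exists (q + p) => x; rewrite big_cons IH fq hornerD.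
Qed.

Lemma polynomial_fun_negbinom (F : numFieldType) (c : F) n :
  polynomial_fun (fun b => negbinom (b + c) n).
Proof.
exists ((n`!%:R^-1)%:P * \prod_(i < n) ('X + (c + i%:R)%:P)) => x.
rewrite hornerM hornerC horner_prod /negbinom /poch mulrC; congr (_ * _).
by apply: eq_bigr => i _; rewrite hornerD hornerX hornerC addrA.
Qed.

(** A polynomial with infinitely many roots is zero. *)
Lemma polynomial_fun_eq (F : numFieldType) (f g : F -> F) n0 :
  polynomial_fun f -> polynomial_fun g ->
  (forall N, (n0 <= N)%N -> f (- N%:R) = g (- N%:R)) -> f =1 g.
Proof.
move=> [p fp] [q gq] fg x; rewrite fp gq; congr (_.[x]); apply/eqP.
rewrite -subr_eq0; apply/negPn/negP => d0.
set d := p - q in d0.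
pose s := [seq (- (n0 + i)%:R : F) | i <- iota 0 (size d)].
have rs : all (root d) s.
  apply/allP => _ /mapP[i _ ->]; rewrite /root /d hornerD hornerN.
  by rewrite -fp -gq fg ?leq_addr // subrr.
have us : uniq s.
  rewrite map_inj_uniq ?iota_uniq // => i j /oppr_inj /eqP.
  by rewrite eqr_nat eqn_add2l => /eqP.
by have := max_poly_roots d0 rs us; rewrite size_map size_iota ltnn.
Qed.

(** Both sides are polynomials in b, and they agree at b = - N for N >= 2 m, where
    the sums over j are finite. *)
Lemma linearized_sumE (F : numFieldType) (m : nat) (b tau y : F) :
  1 - y != 0 -> linearized_sum m b tau y = diag_sum m b tau y.
Proof.
move=> y1; move: b.
have P0 n : polynomial_fun (fun b : F => negbinom b n).
  by have [p pP] := polynomial_fun_negbinom (0 : F) n; exists p => x; rewrite -pP addr0.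
have Pc k : polynomial_fun (fun b : F => meixner_coef m b tau k).
  do 2![apply: polynomial_funM; last exact: polynomial_fun_cst].
  exact: polynomial_fun_negbinom.
apply: (@polynomial_fun_eq _ _ _ (2 * m)) => [||N mN]; last exact: linearized_sumN.
- do 3![apply: polynomial_fun_sum => ?].
  apply: polynomial_funM.
    by do 2?[apply: polynomial_funM] => //; exact: polynomial_fun_cst.
  by do 2![apply: polynomial_funM; last exact: polynomial_fun_cst].
- apply: polynomial_fun_sum => l.
  do 2![apply: polynomial_funM; last exact: polynomial_fun_cst].
  apply: polynomial_funM; first exact: P0.
  exact: (polynomial_funM (polynomial_fun_negbinom _ _) (polynomial_fun_negbinom _ _)).
Qed.

(** * Jacobi polynomials *)

Lemma jacobi_negbinom (F : numFieldType) (n d : nat) (b tau : F) :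
  jacobi n d%:R (b - 1) (1 - 2 * tau) =
  \sum_(k < n.+1) 'C(n + d, k)%:R * negbinom (b + k%:R) (n - k)
     * (- tau) ^+ (n - k) * (1 - tau) ^+ k.
Proof.
rewrite /jacobi; apply: eq_bigr => k _; have kn : (k <= n)%N by rewrite -ltnS.
rewrite -natrD gbinom_nat; last exact: leq_trans kn (leq_addr _ _).
rewrite gbinom_negbinom //.
have -> : (1 - 2 * tau - 1) / 2 = - tau by field.
by have -> : (1 - 2 * tau + 1) / 2 = 1 - tau by field.
Qed.

Lemma meixner_jacobi_ge (F : numFieldType) (m j : nat) (b tau : F) :
  (m <= j)%N ->
  meixner m b tau j = jacobi m (j - m)%:R (b - 1) (1 - 2 * tau).
Proof. by move=> mj; rewrite jacobi_negbinom subnKC. Qed.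

(** The reflection of Jacobi polynomials in a negative integer first parameter;
    here it holds term by term. *)
Lemma meixner_jacobi_le (F : numFieldType) (m j : nat) (b tau : F) :
  (j <= m)%N ->
  meixner m b tau j =
  j`!%:R / m`!%:R * poch (b + j%:R) (m - j) * (- tau) ^+ (m - j)
  * jacobi j (m - j)%:R (b - 1) (1 - 2 * tau).
Proof.
move=> jm; rewrite jacobi_negbinom subnKC // mulr_sumr /meixner.
pose G k := 'C(m, k)%:R * negbinom (b + k%:R) (j - k) * (- tau) ^+ (j - k)
   * (1 - tau) ^+ k.
rewrite [RHS](sum_ord_pad j (m - j) (fun k => j`!%:R / m`!%:R *
  poch (b + j%:R) (m - j) * (- tau) ^+ (m - j) * G k)) subnKC //.
apply: eq_bigr => k _; have km : (k <= m)%N by rewrite -ltnS.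
case: (leqP k j) => kj; last by rewrite bin_small // !mul0r.
have E : (m - k = (j - k) + (m - j))%N by lia.
rewrite /G E exprD /negbinom pochD.
have -> : b + k%:R + (j - k)%:R = b + j%:R by rewrite natrB //; ring.
rewrite (natr_bin _ kj) (natr_bin _ km) E; field; by rewrite !fact_neq0.
Qed.

(** The polynomial in the theorem, obtained from the explicit sum of the Jacobi
    polynomial by distributing the m-th power over its terms; no denominator
    then vanishes at tau. *)
Definition jacobi_factor (F : numFieldType) (m : nat) (a tau : F) : {poly F} :=
  \sum_(k < m.+1) (gbinom (m%:R + a) k * 'C(m, m - k)%:R / (1 - tau) ^+ (2 * m))%:P
    * ('X * ((1 - tau) ^+ 2)%:P) ^+ (m - k) * (tau%:P * (1 - 'X) ^+ 2) ^+ k.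

Lemma horner_jacobi_factor (F : numFieldType) (m : nat) (a tau x : F) :
  (jacobi_factor m a tau).[x] =
  \sum_(k < m.+1) gbinom (m%:R + a) k * 'C(m, m - k)%:R / (1 - tau) ^+ (2 * m)
    * (x * (1 - tau) ^+ 2) ^+ (m - k) * (tau * (1 - x) ^+ 2) ^+ k.
Proof.
rewrite /jacobi_factor horner_sum; apply: eq_bigr => k _.
by rewrite !hornerE.
Qed.

Lemma jacobi_factorE (F : numFieldType) (m : nat) (a tau x : F) :
  1 - tau != 0 -> (tau - x) * (1 - tau * x) != 0 ->
  (jacobi_factor m a tau).[x] =
  ((tau - x) * (1 - tau * x) / (1 - tau) ^+ 2) ^+ m
  * jacobi m a 0 (1 + 2 * x * (1 - tau) ^+ 2 / ((tau - x) * (1 - tau * x))).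
Proof.
move=> t1 D0; rewrite horner_jacobi_factor /jacobi mulr_sumr.
apply: eq_bigr => k _; have km : (k <= m)%N by rewrite -ltnS.
rewrite addr0 [gbinom m%:R _]gbinom_nat ?leq_subr //.
set D := (tau - x) * (1 - tau * x).
have -> : (1 + 2 * x * (1 - tau) ^+ 2 / D - 1) / 2 = x * (1 - tau) ^+ 2 / D.
  by field.
(* (tau - x)(1 - tau x) + x (1 - tau)^2 = tau (1 - x)^2. *)
have -> : (1 + 2 * x * (1 - tau) ^+ 2 / D + 1) / 2 = tau * (1 - x) ^+ 2 / D.
  by rewrite /D; field; move: D0; rewrite mulf_eq0 negb_or andbC.
rewrite expr_div_n -exprM -[in D ^+ m](subnK km) exprD !expr_div_n.
by field; rewrite !expf_neq0.
Qed.

(** The terms correspond under l = m - k.  One of the two negative binomials of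
    index m - l becomes C(m, l) by [negbinom_shift], the other is the generalised
    binomial of the Jacobi polynomial. *)
Lemma diag_sum_jacobi_factor (F : numFieldType) (m : nat) (b tau x : F) :
  1 - tau != 0 ->
  diag_sum m b tau (tau * x) =
  negbinom b m * tau ^+ m * (1 - tau) ^+ (2 * m)
  * (jacobi_factor m (b - 1) tau).[x].
Proof.
move=> t1; rewrite horner_jacobi_factor mulr_sumr /diag_sum.
rewrite (reindex_inj rev_ord_inj) /=; apply: eq_bigr => k _.
have km : (k <= m)%N by rewrite -ltnS.
rewrite subSS subKn //.
have := gbinom_negbinom b (leq_subr k m); rewrite subKn // => ->.
have := negbinom_shift b (m - k) k; rewrite subnK // => E.
rewrite [negbinom (b + _) k ^+ 2]expr2 [negbinom b (m - k) * _]mulrA -E.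
have -> : (tau - tau * x) ^+ (2 * k) = tau ^+ k * (tau * (1 - x) ^+ 2) ^+ k.
  by rewrite exprM -exprMn; congr (_ ^+ _); ring.
have -> : (tau * x * (1 - tau) ^+ 2) ^+ (m - k) =
    tau ^+ (m - k) * (x * (1 - tau) ^+ 2) ^+ (m - k).
  by rewrite -exprMn; congr (_ ^+ _); ring.
rewrite -[in tau ^+ m](subnK km) exprD.
by field; rewrite expf_neq0.
Qed.

(** * The Gamma function at arguments at least 1 *)

Definition gamma_integrand (K : realType) (p t : K) : K := t `^ p * expR (- t).

Lemma gamma_integrand_ge0 (K : realType) (p t : K) : 0 <= gamma_integrand p t.
Proof. by rewrite mulr_ge0 ?powR_ge0 ?expR_ge0. Qed.

(** With c = 2 p + 2, the inequality ln x < x at x = t / c gives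
    t^p <= c^p exp (p t / c), and p / c <= 1 / 2. *)
Lemma gamma_integrand_le (K : realType) (p : K) : 0 <= p ->
  exists2 C : K, 0 < C & forall t, 0 <= t ->
    gamma_integrand p t <= C * expR (- (2^-1 * t)).
Proof.
move=> p0; pose c : K := 2 * p + 2; have c0 : 0 < c by rewrite /c; lra.
exists (c `^ p) => [|t]; first by rewrite powR_gt0.
rewrite le_eqVlt => /predU1P[<-|t0].
  rewrite /gamma_integrand mulr0 oppr0 expR0 !mulr1.
  by apply: ge0_ler_powR; rewrite ?nnegrE //; exact: ltW.
have h : t `^ p <= c `^ p * expR (2^-1 * t).
  have -> : t `^ p = c `^ p * (t / c) `^ p.
    by rewrite -powRM ?divr_ge0 ?ltW // mulrC divfK // gt_eqF.
  rewrite ler_pM2l ?powR_gt0 // /powR gt_eqF ?divr_gt0 // ler_expR.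
  have tc : ln (t / c) <= t / c by rewrite ltW // ln_sublinear // divr_gt0.
  apply: (le_trans (ler_wpM2l p0 tc)); rewrite mulrCA mulrC ler_pM2r //.
  by rewrite ler_pdivrMr // /c; lra.
rewrite /gamma_integrand.
apply: (le_trans (ler_wpM2r (expR_ge0 _) h)); rewrite -mulrA -expRD.
by rewrite ler_pM2l ?powR_gt0 // ler_expR; lra.
Qed.

Lemma is_derive_gamma_integrand (K : realType) (p t : K) : 0 < t ->
  is_derive t 1 (gamma_integrand (p + 1))
    ((p + 1) * gamma_integrand p t - gamma_integrand (p + 1) t).
Proof.
move=> t0.
have d1 := is_derive1_powR (p + 1) t0.
rewrite /gamma_integrand; apply: is_derive_eq; rewrite addrK /GRing.scale /=; ring.
Qed.

Lemma cvg_gamma_integrand0 (K : realType) (p : K) : 0 <= p ->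
  gamma_integrand p t @[t --> 0^'+] --> gamma_integrand p 0.
Proof.
move=> p0; apply: cvgM.
  move: p0; rewrite le_eqVlt => /predU1P[<-|p0].
    by under eq_fun do rewrite powRr0; rewrite powRr0; exact: cvg_cst.
  by rewrite powR0 ?gt_eqF //; exact: powR_cvg0.
apply: cvg_at_right_filter; apply: (@continuous_comp _ _ _ -%R expR).
  exact: opp_continuous.
exact: continuous_expR.
Qed.

Lemma within_continuous_gamma_integrand (K : realType) (p : K) : 0 <= p ->
  {within `[0, +oo[, continuous (gamma_integrand p)}.
Proof.
move=> p0; apply/continuous_within_itvcyP; split; last exact: cvg_gamma_integrand0.
move=> t; rewrite in_itv /= andbT => t0.
apply/differentiable_continuous/derivable1_diffP.
have := is_derive_gamma_integrand (p - 1) t0; rewrite subrK => h.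
exact: ex_derive.
Qed.

Lemma cvg_exp_half (K : realType) (M : K) :
  M * expR (- (2^-1 * t)) @[t --> +oo] --> (0 : K).
Proof.
rewrite -(mulr0 M); apply: cvgMr.
have h : 2^-1 * t @[t --> (+oo : set_system K)] --> (+oo : set_system K).
  exact: gt0_cvgMry.
exact: (cvg_comp _ _ h (@cvgr_expR K)).
Qed.

Lemma continuous_exp_half (K : realType) (M : K) :
  continuous (fun t : K => M * expR (- (2^-1 * t))).
Proof.
move=> t; apply/differentiable_continuous/derivable1_diffP; exact: ex_derive.
Qed.

Lemma integral_exp_half (K : realType) (M : K) : 0 <= M ->
  (\int[lebesgue_measure]_(t in `[0%R, +oo[) (M * expR (- (2^-1 * t)))%:E
   = (2 * M)%:E)%E.
Proof.
move=> M0; pose F (t : K) := (- 2 * M) * expR (- (2^-1 * t)).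
have dF (t : K) : is_derive t 1 F (M * expR (- (2^-1 * t))).
  by rewrite /F; apply: is_derive_eq; rewrite /GRing.scale /=; field.
rewrite (@ge0_continuous_FTC2y K _ F 0 0).
- by rewrite /F mulr0 oppr0 expR0 mulr1 -EFinB; congr EFin; ring.
- by move=> x _; rewrite mulr_ge0 ?expR_ge0.
- exact/continuous_subspaceT/continuous_exp_half.
- exact: cvg_exp_half.
- by move=> x _; exact: ex_derive.
- exact/cvg_at_right_filter/continuous_exp_half.
- by move=> x _; rewrite derive1E derive_val.
Qed.

Lemma cvg_gamma_integrandy (K : realType) (p : K) : 0 <= p ->
  gamma_integrand p t @[t --> +oo] --> (0 : K).
Proof.
move=> p0; have [C C0 hC] := gamma_integrand_le p0.
apply: (squeeze_cvgr _ (cvg_cst 0) (cvg_exp_half C)).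
by near=> t; rewrite gamma_integrand_ge0 hC.
Unshelve. all: by end_near. Qed.

(** Euler's integral at p + 1 with values in the extended reals, where nonnegative
    integrals add without integrability conditions. *)
Definition egamma (K : realType) (p : K) : \bar K :=
  (\int[lebesgue_measure]_(t in `[0%R, +oo[) (gamma_integrand p t)%:E)%E.

Lemma measurable_EFin (K : realType) (D : set K) (f : K -> K) :
  measurable_fun D f -> measurable_fun D (fun t => (f t)%:E).
Proof. by move=> mf; apply/measurable_EFinP. Qed.

Lemma measurable_gamma_integrand (K : realType) (p : K) (D : set K) :
  measurable_fun D (gamma_integrand p).
Proof.
apply: measurable_funTS; apply: measurable_funM; first exact: measurable_powR.
by apply: measurableT_comp => //; exact: measurable_expR.
Qed.

Lemma measurable_exp_half (K : realType) (M : K) (D : set K) :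
  measurable_fun D (fun t : K => M * expR (- (2^-1 * t))).
Proof.
apply: measurable_funTS; apply: continuous_measurable_fun.
exact: continuous_exp_half.
Qed.

Lemma egamma_lty (K : realType) (p : K) : 0 <= p -> (egamma p < +oo)%E.
Proof.
move=> p0; have [C C0 hC] := gamma_integrand_le p0.
apply: (@le_lt_trans _ _ (2 * C)%:E); last by rewrite ltry.
rewrite -(integral_exp_half (ltW C0)) /egamma; apply: ge0_le_integral => //=.
- by move=> t _; rewrite lee_fin gamma_integrand_ge0.
- by apply: measurable_EFin; exact: measurable_gamma_integrand.
- by apply: measurable_EFin; exact: measurable_exp_half.
- by move=> t; rewrite in_itv /= andbT lee_fin; exact: hC.
Qed.

(** Integration by parts would use the signed integrand
    t^(p + 1) e^(- t) - (p + 1) t^p e^(- t).  Adding a large multiple M of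
    e^(- t / 2), whose integral is 2 M, makes it nonnegative, so that the
    fundamental theorem of calculus for nonnegative functions on a half line
    applies. *)
Lemma egamma_recurrence (K : realType) (p : K) : 0 <= p ->
  egamma (p + 1) = ((p + 1)%:E * egamma p)%E.
Proof.
move=> p0; have [C C0 hC] := gamma_integrand_le p0.
have p10 : 0 <= p + 1 by rewrite addr_ge0.
pose M := (p + 1) * C; have M0 : 0 <= M by rewrite mulr_ge0 // ltW.
pose e (t : K) := M * expR (- (2^-1 * t)).
pose f (t : K) := gamma_integrand (p + 1) t - (p + 1) * gamma_integrand p t + e t.
have f0 t : 0 <= t -> 0 <= f t.
  move=> t0; rewrite /f -addrA addr_ge0 ?gamma_integrand_ge0 // addrC subr_ge0.
  by rewrite /e /M -mulrA ler_wpM2l // hC.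
pose F (t : K) := - gamma_integrand (p + 1) t + (- 2 * M) * expR (- (2^-1 * t)).
have dF (t : K) : 0 < t -> is_derive t 1 F (f t).
  move=> t0; have h := is_derive_gamma_integrand p t0.
  by rewrite /F; apply: is_derive_eq; rewrite /f /e /GRing.scale /=; field.
have If : (\int[lebesgue_measure]_(t in `[0%R, +oo[) (f t)%:E = (2 * M)%:E)%E.
  rewrite (@ge0_continuous_FTC2y K f F 0 0) //.
  - rewrite /F mulr0 oppr0 expR0 mulr1 /gamma_integrand powR0 ?mul0r ?oppr0 ?add0r.
      by rewrite -EFinN mulNr opprK.
    by rewrite gt_eqF // ltr_wpDl.
  - move=> t; apply: cvgD; last exact/continuous_subspaceT/continuous_exp_half.
    apply: cvgB; first exact: within_continuous_gamma_integrand.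
    by apply: cvgMr; exact: within_continuous_gamma_integrand.
  - have h := cvgD (cvgN (cvg_gamma_integrandy p10)) (cvg_exp_half (- 2 * M)).
    by rewrite oppr0 addr0 in h; exact: h.
  - by move=> t t0; have := dF t t0 => h; exact: ex_derive.
  - apply: cvgD; first by apply: cvgN; exact: cvg_gamma_integrand0.
    exact/cvg_at_right_filter/continuous_exp_half.
  - move=> t; rewrite in_itv /= andbT => t0; have h := dF t t0.
    by rewrite derive1E derive_val.
have key : (egamma (p + 1) + (2 * M)%:E = (2 * M)%:E + (p + 1)%:E * egamma p)%E.
  rewrite -{1}(integral_exp_half M0) -If.
  rewrite /egamma -ge0_integralZl //=; last 2 first.
  - by apply: measurable_EFin; exact: measurable_gamma_integrand.
  - by move=> t _; rewrite lee_fin gamma_integrand_ge0.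
  rewrite -!ge0_integralD //=.
  - apply: eq_integral => t _; rewrite -!EFinM -!EFinD; congr EFin.
    by rewrite /f /e; ring.
  - by move=> t; rewrite in_itv /= andbT lee_fin; exact: f0.
  - apply: measurable_EFin; apply: measurable_funD; last exact: measurable_exp_half.
    apply: measurable_funB; first exact: measurable_gamma_integrand.
    by apply: measurable_funM => //; exact: measurable_gamma_integrand.
  - by move=> t _; rewrite lee_fin mulr_ge0 ?gamma_integrand_ge0.
  - apply: measurable_EFin.
    by apply: measurable_funM => //; exact: measurable_gamma_integrand.
  - by move=> t _; rewrite lee_fin gamma_integrand_ge0.
  - by apply: measurable_EFin; exact: measurable_gamma_integrand.
  - by move=> t _; rewrite lee_fin mulr_ge0 ?expR_ge0.
  - by apply: measurable_EFin; exact: measurable_exp_half.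
by rewrite -[LHS](@addeK _ (2 * M)%:E) // key [(_ + (_ * _))%E]addeC addeK.
Qed.

(** For t >= 1 the integrand is at least e^(- t), whose integral there is 1 / e. *)
Lemma egamma_gt0 (K : realType) (p : K) : 0 <= p -> (0 < egamma p)%E.
Proof.
move=> p0.
apply: (@lt_le_trans _ _ (\int[lebesgue_measure]_(t in `[1%R, +oo[)
  (gamma_integrand p t)%:E)%E); last first.
  apply: ge0_subset_integral => //=.
  - by apply: measurable_EFin; exact: measurable_gamma_integrand.
  - by move=> t _; rewrite lee_fin gamma_integrand_ge0.
  - by move=> t /=; rewrite !in_itv /= !andbT; apply: le_trans.
apply: (@lt_le_trans _ _ (\int[lebesgue_measure]_(t in `[1%R, +oo[)
  (expR (- t))%:E)%E); last first.
  apply: ge0_le_integral => //=.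
  - apply: measurable_EFin; apply: measurable_funTS.
    by apply: measurableT_comp => //; exact: measurable_expR.
  - by apply: measurable_EFin; exact: measurable_gamma_integrand.
  - move=> t; rewrite in_itv /= andbT lee_fin => t1.
    rewrite -[leLHS]mul1r ler_wpM2r ?expR_ge0 //.
    by rewrite -(powRr0 t) ler_powR.
pose F (t : K) := - expR (- t).
have dF (t : K) : is_derive t 1 F (expR (- t)).
  by rewrite /F; apply: is_derive_eq; rewrite /GRing.scale /=; ring.
have ce : continuous (fun t : K => expR (- t)).
  by move=> t; apply/differentiable_continuous/derivable1_diffP; exact: ex_derive.
rewrite (@ge0_continuous_FTC2y K _ F 1 0).
- by rewrite /F -EFinB sub0r opprK lte_fin expR_gt0.
- by move=> x _; exact: expR_ge0.
- exact/continuous_subspaceT.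
- by have h := cvgN (@cvgr_expR K); rewrite oppr0 in h; exact: h.
- by move=> x _; exact: ex_derive.
- by apply: cvg_at_right_filter; apply: cvgN; exact: ce.
- by move=> x _; rewrite derive1E derive_val.
Qed.

Lemma Gamma_egamma (K : realType) (x : K) : Gamma x = fine (egamma (x - 1)).
Proof.
rewrite /Gamma /Rintegral /egamma; congr fine.
rewrite integral_itv_obnd_cbnd //.
by apply: measurable_EFin; exact: measurable_gamma_integrand.
Qed.

Lemma Gamma_gt0 (K : realType) (x : K) : 1 <= x -> 0 < Gamma x.
Proof.
move=> x1; have p0 : 0 <= x - 1 by rewrite subr_ge0.
by rewrite Gamma_egamma fine_gt0 // egamma_gt0 // egamma_lty.
Qed.

Lemma GammaS (K : realType) (x : K) : 1 <= x -> Gamma (x + 1) = x * Gamma x.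
Proof.
move=> x1; have p0 : 0 <= x - 1 by rewrite subr_ge0.
rewrite !Gamma_egamma.
have -> : x + 1 - 1 = (x - 1) + 1 by ring.
rewrite egamma_recurrence // subrK fineM // fin_num_abs gee0_abs.
  exact: egamma_lty.
exact/ltW/egamma_gt0.
Qed.

(** * The principal power on the right half plane *)

Lemma cexp0 (K : realType) : cexp (0 : K[i]) = 1.
Proof. by rewrite /cexp /= expR0 cos0 sin0 mulr1 mulr0. Qed.

Lemma cexpD (K : realType) (u v : K[i]) : cexp (u + v) = cexp u * cexp v.
Proof.
case: u => a b; case: v => c d; rewrite /cexp /= expRD cosD sinD.
by apply/eqP; rewrite eq_complex /=; apply/andP; split; apply/eqP; ring.
Qed.

Lemma cexpN (K : realType) (u : K[i]) : cexp (- u) = (cexp u)^-1.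
Proof.
have h : cexp u * cexp (- u) = 1 by rewrite -cexpD subrr cexp0.
have u0 : cexp u != 0.
  by apply: contra_eq_neq h => ->; rewrite mul0r eq_sym oner_eq0.
by rewrite -[LHS](mulKf u0) h mulr1.
Qed.

Lemma cexp_real (K : realType) (x : K) : cexp x%:C = (expR x)%:C.
Proof. by rewrite /cexp /= cos0 sin0 mulr1 mulr0. Qed.

Lemma normc_gt0 (K : realType) (u : K[i]) : u != 0 -> 0 < normc u.
Proof.
move=> u0; rewrite lt_neqAle eq_sym; apply/andP; split.
  by apply: contra_neq u0; exact: eq0_normc.
by case: u {u0} => a b; rewrite /normc sqrtr_ge0.
Qed.

Lemma sqr_normc (K : realType) (u : K[i]) :
  normc u ^+ 2 = complex.Re u ^+ 2 + complex.Im u ^+ 2.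
Proof. by case: u => a b; rewrite /normc sqr_sqrtr // addr_ge0 ?sqr_ge0. Qed.

Lemma cexp_clog (K : realType) (u : K[i]) : u != 0 -> cexp (clog u) = u.
Proof.
move=> u0; have := normc_gt0 u0; have := sqr_normc u.
case: u {u0} => a b /=; rewrite /clog /cexp -/(normc (a +i* b)).
set r := normc _ => r2 r0; rewrite lnK // /carg -/r.
have ar : -1 <= a / r <= 1.
  rewrite -ler_norml normrM normfV (gtr0_norm r0) ler_pdivrMr // mul1r.
  rewrite -[leRHS](gtr0_norm r0) -ler_sqr ?nnegrE // !real_normK ?num_real //.
  by rewrite r2 lerDl sqr_ge0.
have ca : cos (acos (a / r)) = a / r by rewrite acosK // in_itv.
have sa : sin (acos (a / r)) = `|b| / r.
  rewrite sin_acos //; have -> : 1 - (a / r) ^+ 2 = (`|b| / r) ^+ 2.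
    rewrite !expr_div_n real_normK ?num_real // r2.
    by field; rewrite -r2 expf_neq0 // gt_eqF.
  by rewrite sqrtr_sqr ger0_norm // divr_ge0 // ltW.
apply/eqP; rewrite eq_complex /=; apply/andP.
case: ifP => b0; rewrite ?cosN ?sinN ca sa; split; apply/eqP.
- by rewrite mulrC divfK // gt_eqF.
- by rewrite ger0_norm // mulrC divfK // gt_eqF.
- by rewrite mulrC divfK // gt_eqF.
- by rewrite ltr0_norm ?ltNge ?b0 // mulNr opprK mulrC divfK // gt_eqF.
Qed.

(** On the right half plane the argument is an arctangent, which unlike the
    arccosine is differentiable also across the real axis. *)
Lemma clogE (K : realType) (u : K[i]) : 0 < complex.Re u ->
  clog u = (2^-1 * ln (complex.Re u ^+ 2 + complex.Im u ^+ 2))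
           +i* atan (complex.Im u / complex.Re u).
Proof.
case: u => a b /= a0; have r2 := sqr_normc (a +i* b); rewrite /= in r2.
have r0 : 0 < normc (a +i* b).
  by apply: normc_gt0; rewrite eq_complex /= gt_eqF.
rewrite /clog; congr (_ +i* _).
  by rewrite -r2 /= lnXn // -mulr_natl; field.
have E (c : K) : 0 <= c -> c ^+ 2 = b ^+ 2 -> acos (a / normc (a +i* b)) = atan (c / a).
  move=> c0 cb; have -> : a / normc (a +i* b) = cos (atan (c / a)).
    rewrite cos_atan.
    have -> : 1 + (c / a) ^+ 2 = (normc (a +i* b) / a) ^+ 2.
      by rewrite !expr_div_n r2 cb; field; rewrite gt_eqF.
    by rewrite sqrtr_sqr ger0_norm ?divr_ge0 ?ltW // invf_div.
  rewrite cosK // in_itv /=; apply/andP; split.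
    by rewrite -atan0 le_atan // divr_ge0 // ltW.
  apply: (le_trans (ltW (atan_ltpi2 _))); rewrite ler_pdivrMr // ler_peMr ?pi_ge0 //.
  by rewrite ler1n.
rewrite /carg; case: ifP => b0; first exact: E.
have b1 : b < 0 by rewrite ltNge b0.
by rewrite (E (- b)) ?oppr_ge0 ?ltW ?sqrrN // mulNr atanN opprK.
Qed.

Lemma clog_div (K : realType) (r : K) (u : K[i]) :
  0 < r -> 0 < complex.Re u -> clog (r%:C / u) = (ln r)%:C - clog u.
Proof.
move=> r0 u0; case: u u0 => a b /= a0.
have rho : 0 < a ^+ 2 + b ^+ 2 by rewrite ltr_pwDl ?exprn_gt0 ?sqr_ge0.
have -> : r%:C / (a +i* b) =
    (r * a / (a ^+ 2 + b ^+ 2)) +i* (- (r * b / (a ^+ 2 + b ^+ 2))).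
  apply/eqP; rewrite eq_complex /=; apply/andP; split; apply/eqP; ring.
rewrite !clogE //= ?divr_gt0 ?mulr_gt0 //.
apply/eqP; rewrite eq_complex /=; apply/andP; split; apply/eqP.
  have -> : (r * a / (a ^+ 2 + b ^+ 2)) ^+ 2 + (- (r * b / (a ^+ 2 + b ^+ 2))) ^+ 2
    = r ^+ 2 / (a ^+ 2 + b ^+ 2) by field; rewrite gt_eqF.
  rewrite ln_div ?posrE ?exprn_gt0 // lnXn // -mulr_natl.
  by field.
rewrite sub0r -atanN; congr atan; field.
by rewrite !gt_eqF.
Qed.

Lemma cpow_div (K : realType) (r s : K) (u : K[i]) :
  0 < r -> 0 < complex.Re u ->
  cpow (r%:C / u) s%:C = (r `^ s)%:C / cpow u s%:C.
Proof.
move=> r0 u0; rewrite /cpow clog_div // mulrBr cexpD cexpN; congr (_ / _).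
have -> : s%:C * (ln r)%:C = (s * ln r)%:C by rewrite rmorphM.
by rewrite cexp_real /powR gt_eqF.
Qed.

Lemma cpowDn (K : realType) (s : K) (n : nat) (u : K[i]) : u != 0 ->
  cpow u (s + n%:R)%:C = cpow u s%:C * u ^+ n.
Proof.
move=> u0; elim: n => [|n IH]; first by rewrite addr0 expr0 mulr1.
rewrite -natr1 addrA exprSr mulrA -IH.
have -> : (s + n%:R + 1)%:C = (s + n%:R)%:C + 1 by rewrite rmorphD rmorph1.
by rewrite /cpow mulrDl mul1r cexpD cexp_clog.
Qed.

Lemma cpow_neq0 (K : realType) (u s : K[i]) : cpow u s != 0.
Proof.
have h : cexp (s * clog u) * cexp (- (s * clog u)) = 1 by rewrite -cexpD subrr cexp0.
by apply: contra_eq_neq h; rewrite /cpow => ->; rewrite mul0r eq_sym oner_eq0.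
Qed.

(** * The complex binomial series *)

Lemma negbinom_ge0 (K : numFieldType) (b : K) n : 0 < b -> 0 <= negbinom b n.
Proof. by move=> b0; rewrite divr_ge0 // ltW // poch_gt0. Qed.

Lemma negbinomS (K : numFieldType) (b : K) n :
  n.+1%:R * negbinom b n.+1 = (b + n%:R) * negbinom b n.
Proof.
rewrite /negbinom pochS factS natrM; field.
by rewrite fact_neq0 /= addrC natr1 pnatr_eq0.
Qed.

Lemma negbinomSl (K : numFieldType) (b : K) n :
  n.+1%:R * negbinom b n.+1 = b * negbinom (b + 1) n.
Proof.
rewrite /negbinom -[n.+1]add1n pochD /poch big_ord1 add1n factS natrM addr0; field.
by rewrite fact_neq0 /= addrC natr1 pnatr_eq0.
Qed.

(** The coefficient form of (1 - x) (1 - x)^(- b - 1) = (1 - x)^(- b). *)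
Lemma negbinom_pascal (K : numFieldType) (b : K) n :
  negbinom (b + 1) n.+1 = negbinom b n.+1 + negbinom (b + 1) n.
Proof.
have n0 : n.+1%:R != 0 :> K by rewrite pnatr_eq0.
apply: (mulfI n0); rewrite mulrDr negbinomS negbinomSl -natr1; ring.
Qed.

(** The ratio test: for r < q the ratio of consecutive terms,
    (b + n) r / (n + 1), is at most q from some J on. *)
Lemma negbinom_geometric_bound (K : realType) (b r : K) :
  0 < b -> 0 <= r < 1 ->
  exists C q : K, [/\ 0 < q, q < 1 & forall n, negbinom b n * r ^+ n <= C * q ^+ n].
Proof.
move=> b0 /andP[r0 r1]; pose q := (r + 1) / 2.
have q0 : 0 < q by rewrite /q; lra.
have q1 : q < 1 by rewrite /q; lra.
have rq : 0 < q - r by rewrite /q; lra.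
pose v n := negbinom b n * r ^+ n / q ^+ n.
have v0 n : 0 <= v n.
  by rewrite divr_ge0 ?exprn_ge0 ?(ltW q0) // mulr_ge0 ?negbinom_ge0 ?exprn_ge0.
have [J hJ] : exists J : nat, b * r / (q - r) <= J%:R.
  by exists (Num.truncn (b * r / (q - r))).+1; rewrite ltW // truncnS_gt.
have vS n : (J <= n)%N -> v n.+1 <= v n.
  move=> Jn; have n0 : 0 < n.+1%:R :> K by rewrite ltr0n.
  have -> : v n.+1 = v n * ((b + n%:R) * r / (q * n.+1%:R)).
    have := negbinomS b n; move/(canRL (mulKf (lt0r_neq0 n0))) => E.
    rewrite /v E !exprS; field.
    by rewrite gt_eqF //= expf_neq0 ?gt_eqF // addrC natr1 gt_eqF.
  rewrite ler_piMr // ler_pdivrMr; last by rewrite mulr_gt0.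
  rewrite -natr1.
  have : b * r / (q - r) <= n%:R by rewrite (le_trans hJ) // ler_nat.
  rewrite ler_pdivrMr // => h.
  by nra.
pose C := \sum_(i < J.+1) v i.
exists C, q; split=> // n; rewrite -ler_pdivrMr ?exprn_gt0 // -/(v n).
have hC i : (i <= J)%N -> v i <= C.
  move=> iJ; have iJ' : (i < J.+1)%N by [].
  by rewrite /C (bigD1 (Ordinal iJ')) //= lerDl sumr_ge0.
case: (leqP n J) => [|/ltnW Jn]; first exact: hC.
rewrite -(subnK Jn); elim: (n - J)%N => [|k IH]; first exact: hC.
by rewrite addSn (le_trans (vS _ (leq_addl _ _))).
Qed.

Lemma is_cvg_negbinom_pseries (K : realType) (b T rho : K) (p : nat -> K) :
  0 < b -> 0 <= T -> 0 <= rho -> T * rho < 1 ->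
  (forall j, `|p j| <= rho ^+ j) ->
  cvgn (pseries (fun j => negbinom b j * p j) T).
Proof.
move=> b0 T0 r0 Tr hp.
have [|C [q [q0 q1 hq]]] := @negbinom_geometric_bound K b (T * rho) b0.
  by rewrite mulr_ge0.
apply: normed_cvg.
apply: (@series_le_cvg _ _ (geometric C q)).
- by move=> n; exact: normr_ge0.
- move=> n; apply: le_trans (hq n).
  by rewrite mulr_ge0 ?negbinom_ge0 // exprn_ge0 // mulr_ge0.
- move=> n; apply: le_trans (hq n).
  rewrite /= -mulrA normrM (ger0_norm (negbinom_ge0 _ _)) // ler_wpM2l ?negbinom_ge0 //.
  by rewrite exprMn normrM normrX (ger0_norm T0) mulrC ler_wpM2l ?exprn_ge0.
- by apply: is_cvg_geometric_series; rewrite gtr0_norm.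
Qed.

Lemma pseries_negbinom_diffs (K : realType) (b : K) (p : nat -> K) :
  pseries_diffs (fun j => negbinom b j * p j) =
  (fun j => b * (negbinom (b + 1) j * p j.+1)).
Proof.
by apply/funext => j; rewrite /pseries_diffs [LHS]mulrA negbinomSl -mulrA.
Qed.

Lemma cvg_pseriesZ (K : realType) (a : K) (c : nat -> K) (t : K) :
  cvgn (pseries c t) ->
  pseries (fun j => a * c j) t @ \oo --> a * limn (pseries c t).
Proof.
move=> cc; have -> : pseries (fun j => a * c j) t = (fun n => a * pseries c t n).
  apply/funext => n; rewrite /pseries /series /= mulr_sumr.
  by apply: eq_bigr => j _; rewrite mulrA.
by apply: cvgMr; exact: cc.
Qed.

Lemma is_cvg_pseriesZ (K : realType) (a : K) (c : nat -> K) (t : K) :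
  cvgn (pseries c t) -> cvgn (pseries (fun j => a * c j) t).
Proof. by move=> cc; apply/cvg_ex; eexists; exact: cvg_pseriesZ. Qed.

(** The sequences p of interest are the real and the imaginary parts of w^j: the
    binomial series at t w then has these sums as its real and imaginary
    parts. *)
Definition negbinom_psum (K : realType) (b : K) (p : nat -> K) (t : K) : K :=
  limn (pseries (fun j => negbinom b j * p j) t).

(** Since (n + 1) [negbinom b (n + 1)] = b [negbinom (b + 1) n], termwise
    differentiation raises the exponent and shifts p. *)
Lemma is_derive_negbinom_psum (K : realType) (b T t rho : K) (p : nat -> K) :
  0 < b -> 0 <= T -> 0 <= rho <= 1 -> T * rho < 1 ->
  (forall j, `|p j| <= rho ^+ j) -> `|t| < T ->
  is_derive t 1 (negbinom_psum b p)
    (b * negbinom_psum (b + 1) (fun j => p j.+1) t).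
Proof.
move=> b0 T0 /andP[r0 r1] Tr hp tT.
have hpS (p' : nat -> K) : (forall j, `|p' j| <= rho ^+ j) ->
    forall j, `|p' j.+1| <= rho ^+ j.
  by move=> h j; rewrite (le_trans (h _)) // exprS ler_piMl // exprn_ge0.
have c1 (b' x : K) (p' : nat -> K) : 0 < b' -> 0 <= x <= T ->
    (forall j, `|p' j| <= rho ^+ j) ->
    cvgn (pseries (fun j => negbinom b' j * p' j) x).
  move=> b'0 /andP[x0 xT] h; apply: is_cvg_negbinom_pseries h => //.
  by apply: le_lt_trans Tr; rewrite ler_wpM2r.
have b10 : 0 < b + 1 by rewrite addr_gt0.
have TT : 0 <= T <= T by rewrite T0 lexx.
rewrite /negbinom_psum.
have dd : pseries_diffs (pseries_diffs (fun j => negbinom b j * p j)) =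
    (fun j => b * ((b + 1) * (negbinom (b + 1 + 1) j * p j.+2))).
  rewrite pseries_negbinom_diffs; apply/funext => j.
  by rewrite /pseries_diffs mulrCA [_ * (_ * p _)]mulrA negbinomSl !mulrA.
have h := @pseries_snd_diffs K (fun j => negbinom b j * p j) T t.
rewrite dd pseries_negbinom_diffs in h.
apply: is_derive_eq; first apply: h.
- exact: c1.
- by apply: is_cvg_pseriesZ; apply: c1 => //; apply: hpS.
- do 2![apply: is_cvg_pseriesZ]; apply: c1; rewrite ?addr_gt0 //.
  by apply: (hpS (fun j => p j.+1)); apply: hpS.
- by rewrite (ger0_norm T0).
apply/cvg_lim => //; apply: cvg_pseriesZ.
have : cvgn (pseries (fun j => negbinom (b + 1) j * p j.+1) T).
  by apply: c1 => //; apply: hpS.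
by move/is_cvg_pseries_inside; apply; rewrite (ger0_norm T0).
Qed.

Lemma negbinom_psumS (K : realType) (b t rho : K) (p : nat -> K) :
  0 < b -> 0 <= t -> 0 <= rho <= 1 -> t * rho < 1 ->
  (forall j, `|p j| <= rho ^+ j) ->
  negbinom_psum b p t =
  negbinom_psum (b + 1) p t - t * negbinom_psum (b + 1) (fun j => p j.+1) t.
Proof.
move=> b0 t0 /andP[r0 r1] tr hp.
have b10 : 0 < b + 1 by rewrite addr_gt0.
have hp1 j : `|p j.+1| <= rho ^+ j.
  by rewrite (le_trans (hp _)) // exprS ler_piMl // exprn_ge0.
have cb := is_cvg_negbinom_pseries b0 t0 r0 tr hp.
have cp := is_cvg_negbinom_pseries b10 t0 r0 tr hp.
have cq := is_cvg_negbinom_pseries b10 t0 r0 tr hp1.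
apply/cvg_lim => //.
rewrite -(cvg_shiftS (pseries _ t)).
have -> : [sequence pseries (fun j => negbinom b j * p j) t n.+1]_n =
    (fun n => pseries (fun j => negbinom (b + 1) j * p j) t n.+1 -
       t * pseries (fun j => negbinom (b + 1) j * p j.+1) t n).
  apply/funext => n; rewrite /pseries /series /= !big_mkord.
  rewrite [in RHS]big_ord_recl [in LHS]big_ord_recl /= !negbinom0 -addrA; congr (_ + _).
  rewrite mulr_sumr -sumrB; apply: eq_bigr => j _.
  by rewrite /bump /= add1n negbinom_pascal exprS; ring.
apply: cvgB; last by apply: cvgMr; exact: cq.
by have := cp; rewrite -(cvg_shiftS (pseries _ t)).
Qed.

Lemma complex_ReD (K : realType) (u v : K[i]) :
  complex.Re (u + v) = complex.Re u + complex.Re v.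
Proof. by case: u; case: v. Qed.

Lemma complex_ImD (K : realType) (u v : K[i]) :
  complex.Im (u + v) = complex.Im u + complex.Im v.
Proof. by case: u; case: v. Qed.

Lemma complex_ReM (K : realType) (u v : K[i]) :
  complex.Re (u * v) =
  complex.Re u * complex.Re v - complex.Im u * complex.Im v.
Proof. by case: u; case: v. Qed.

Lemma complex_ImM (K : realType) (u v : K[i]) :
  complex.Im (u * v) =
  complex.Re u * complex.Im v + complex.Im u * complex.Re v.
Proof. by case: u => a b; case: v => c d /=; rewrite [b * _]mulrC. Qed.

Lemma complex_Re_sum (K : realType) (u : nat -> K[i]) n :
  complex.Re (\sum_(0 <= j < n) u j) = \sum_(0 <= j < n) complex.Re (u j).
Proof.
elim: n => [|n IH]; first by rewrite !big_nil.
by rewrite !big_nat_recr //= -IH complex_ReD.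
Qed.

Lemma complex_Im_sum (K : realType) (u : nat -> K[i]) n :
  complex.Im (\sum_(0 <= j < n) u j) = \sum_(0 <= j < n) complex.Im (u j).
Proof.
elim: n => [|n IH]; first by rewrite !big_nil.
by rewrite !big_nat_recr //= -IH complex_ImD.
Qed.

Lemma norm_Re_le (K : realType) (u : K[i]) : `|complex.Re u| <= normc u.
Proof.
case: u => a b /=; rewrite -sqrtr_sqr; apply: ler_wsqrtr.
by rewrite lerDl sqr_ge0.
Qed.

Lemma norm_Im_le (K : realType) (u : K[i]) : `|complex.Im u| <= normc u.
Proof.
case: u => a b /=; rewrite -sqrtr_sqr; apply: ler_wsqrtr.
by rewrite lerDr sqr_ge0.
Qed.

Lemma normcX (K : realType) (u : K[i]) n : normc (u ^+ n) = normc u ^+ n.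
Proof.
by elim: n => [|n IH]; rewrite ?expr0 ?normc1 // !exprS normcM IH.
Qed.

Lemma normc_ge0 (K : realType) (u : K[i]) : 0 <= normc u.
Proof. by case: u => a b; rewrite /normc sqrtr_ge0. Qed.

Lemma normC_le (K : realType) (u : K[i]) :
  `|u| <= (`|complex.Re u| + `|complex.Im u|)%:C.
Proof.
rewrite normc_def lecR -[leRHS]ger0_norm ?addr_ge0 // -sqrtr_sqr.
apply: ler_wsqrtr; rewrite sqrrD !real_normK ?num_real //.
by rewrite addrAC lerDl mulrn_wge0 // mulr_ge0.
Qed.

Lemma cvg_complex (K : realType) (u : nat -> K[i]) (l : K[i]) :
  (fun n => complex.Re (u n)) @ \oo --> complex.Re l ->
  (fun n => complex.Im (u n)) @ \oo --> complex.Im l ->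
  u @ \oo --> l.
Proof.
move=> /cvgrPdist_lt hr /cvgrPdist_lt hi; apply/cvgrPdist_lt => e.
case: e => e e'; rewrite ltcE /= => /andP[/eqP -> e0].
have e2 : 0 < e / 2 by rewrite divr_gt0.
near=> n.
apply: (le_lt_trans (normC_le _)); rewrite -complexr0 ltcR.
rewrite [ltRHS](splitr e) ltrD //.
  have -> : complex.Re (l - u n) = complex.Re l - complex.Re (u n).
    by case: (l) => a b; case: (u n).
  by near: n; exact: hr.
have -> : complex.Im (l - u n) = complex.Im l - complex.Im (u n).
  by case: (l) => a b; case: (u n).
by near: n; exact: hi.
Unshelve. all: by end_near. Qed.

Lemma negbinom_psum_linear (K : realType) (b t rho x y : K) (p q : nat -> K) :
  0 < b -> 0 <= t -> 0 <= rho -> t * rho < 1 ->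
  (forall j, `|p j| <= rho ^+ j) -> (forall j, `|q j| <= rho ^+ j) ->
  negbinom_psum b (fun j => x * p j + y * q j) t =
  x * negbinom_psum b p t + y * negbinom_psum b q t.
Proof.
move=> b0 t0 r0 tr hp hq; apply/cvg_lim => //.
have -> : pseries (fun j => negbinom b j * (x * p j + y * q j)) t =
  (fun n => x * pseries (fun j => negbinom b j * p j) t n +
            y * pseries (fun j => negbinom b j * q j) t n).
  apply/funext => n; rewrite /pseries /series /= !mulr_sumr -big_split /=.
  by apply: eq_bigr => j _; ring.
apply: cvgD; apply: cvgMr.
- exact: (is_cvg_negbinom_pseries b0 t0 r0 tr hp).
- exact: (is_cvg_negbinom_pseries b0 t0 r0 tr hq).
Qed.

Lemma negbinom_psum0 (K : realType) (b : K) (p : nat -> K) :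
  negbinom_psum b p 0 = p 0%N.
Proof.
apply/cvg_lim => //; rewrite -(cvg_shiftS (pseries _ 0)).
have -> : [sequence pseries (fun j => negbinom b j * p j) 0 n.+1]_n = cst (p 0%N).
  apply/funext => n; rewrite /pseries /series /= big_mkord big_ord_recl /=.
  rewrite negbinom0 expr0 mulr1 mul1r big1 ?addr0 // => i _.
  by rewrite /bump /= add1n expr0n mulr0.
exact: cvg_cst.
Qed.

(** Here (1 - t w)^b = u + i v for w = x + i y, with logarithm L + i th.  The
    derivative of the logarithm is - w / (1 - t w) = dL + i dth. *)
Lemma is_derive_cpow_ray (K : realType) (b x y t : K) : 0 < 1 - t * x ->
  let L t := 2^-1 * ln ((1 - t * x) ^+ 2 + (- (t * y)) ^+ 2) in
  let th t := atan (- (t * y) / (1 - t * x)) in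
  let rho := (1 - t * x) ^+ 2 + (t * y) ^+ 2 in
  let u := expR (b * L t) * cos (b * th t) in
  let v := expR (b * L t) * sin (b * th t) in
  let dL := ((1 - t * x) * - x + t * y * y) / rho in
  let dth := - y / rho in
  is_derive t 1 (fun t => expR (b * L t) * cos (b * th t))
    (b * (dL * u - dth * v)) /\
  is_derive t 1 (fun t => expR (b * L t) * sin (b * th t))
    (b * (dL * v + dth * u)).
Proof.
move=> P0 L th rho u v dL dth.
have r0 : 0 < rho by rewrite /rho ltr_pwDl ?exprn_gt0 ?sqr_ge0.
have r0' : 0 < (1 - t * x) ^+ 2 + (- (t * y)) ^+ 2 by rewrite sqrrN.
have DL : is_derive t 1 L dL.
  have dl := is_derive1_ln r0'.
  rewrite /L; apply: is_derive_eq; rewrite /dL /rho /GRing.scale /=.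
  by field; rewrite ?gt_eqF.
have Dth : is_derive t 1 th dth.
  have dv : is_derive t 1 (fun t => (1 - t * x)^-1) (x / (1 - t * x) ^+ 2).
    apply: is_derive_eq; first by apply: is_deriveV; rewrite gt_eqF.
    by rewrite /GRing.scale /=; field; rewrite gt_eqF.
  rewrite /th; apply: is_derive_eq; rewrite /dth /rho /GRing.scale /=.
  by field; rewrite ?gt_eqF.
split.
  apply: is_derive_eq; rewrite /u /v /GRing.scale /=; ring.
apply: is_derive_eq; rewrite /u /v /GRing.scale /=; ring.
Qed.

Lemma is_derive_eq0_segment (K : realType) (f : K -> K) :
  (forall t : K, 0 <= t <= 1 -> is_derive t 1 f 0) -> f 1 = f 0.
Proof.
move=> df; have [||c _ h] := @MVT K f (fun=> 0) 0 1 ltr01.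
- by move=> t; rewrite in_itv /= => /andP[/ltW t0 /ltW t1]; apply: df; rewrite t0.
- apply: continuous_in_subspaceT => t; rewrite inE /= in_itv /= => /df h.
  by apply/differentiable_continuous/derivable1_diffP; exact: ex_derive.
by move: h; rewrite mul0r => /eqP; rewrite subr_eq0 => /eqP.
Qed.

(** Let F(t) = A + i B be the binomial series at t w and E(t) = u + i v the power
    (1 - t w)^b.  Then F' = b w G and F = (1 - t w) G, where G is the series with
    exponent b + 1, while E' = - b w E / (1 - t w); so (F E)' = 0 on [0, 1], and
    F E is 1 at t = 0. *)
Lemma negbinom_psum_complex (K : realType) (b : K) (w : K[i]) :
  0 < b -> normc w < 1 ->
  (negbinom_psum b (fun j => complex.Re (w ^+ j)) 1
   +i* negbinom_psum b (fun j => complex.Im (w ^+ j)) 1) * cpow (1 - w) b%:C = 1.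
Proof.
move=> b0 w1; pose p j := complex.Re (w ^+ j); pose q j := complex.Im (w ^+ j).
pose x := complex.Re w; pose y := complex.Im w; pose rho := normc w.
have r0 : 0 <= rho by exact: normc_ge0.
have hp j : `|p j| <= rho ^+ j by rewrite /rho -normcX norm_Re_le.
have hq j : `|q j| <= rho ^+ j by rewrite /rho -normcX norm_Im_le.
have pS : (fun j => p j.+1) = (fun j => x * p j + (- y) * q j).
  by apply/funext => j; rewrite /p /q exprS complex_ReM mulNr.
have qS : (fun j => q j.+1) = (fun j => x * q j + y * p j).
  by apply/funext => j; rewrite /p /q exprS complex_ImM.
(* Any T > 1 with T rho < 1: the series has to be differentiated up to t = 1. *)
pose T := 2 / (1 + rho).
have T0 : 0 <= T by rewrite divr_ge0 // addr_ge0.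
have r1 : 0 < 1 + rho by rewrite ltr_pwDl.
have T1 : 1 < T by rewrite /T ltr_pdivlMr // mul1r; move: w1; rewrite -/rho; lra.
have Tr : T * rho < 1.
  by rewrite /T mulrAC ltr_pdivrMr //; move: w1; rewrite -/rho; lra.
have b1 : 0 < b + 1 by rewrite addr_gt0.
have r01 : 0 <= rho <= 1 by rewrite r0 ltW.
pose L (t : K) := 2^-1 * ln ((1 - t * x) ^+ 2 + (- (t * y)) ^+ 2).
pose th (t : K) := atan (- (t * y) / (1 - t * x)).
pose u t := expR (b * L t) * cos (b * th t).
pose v t := expR (b * L t) * sin (b * th t).
pose A t := negbinom_psum b p t; pose B t := negbinom_psum b q t.
have facts (t : K) : 0 <= t <= 1 ->
  is_derive t 1 (fun s => A s * u s - B s * v s) 0 /\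
  is_derive t 1 (fun s => A s * v s + B s * u s) 0.
  move=> /andP[t0 t1].
  have tr : t * rho < 1 by rewrite (le_lt_trans _ w1) // ler_piMl.
  have tT : `|t| < T by rewrite ger0_norm // (le_lt_trans t1).
  have P0 : 0 < 1 - t * x.
    rewrite subr_gt0 (le_lt_trans _ tr) // ler_wpM2l //.
    exact: le_trans (ler_norm _) (norm_Re_le w).
  have [Du Dv] := is_derive_cpow_ray b y P0.
  have DA := is_derive_negbinom_psum b0 T0 r01 Tr hp tT.
  have DB := is_derive_negbinom_psum b0 T0 r01 Tr hq tT.
  have EA := negbinom_psumS b0 t0 r01 tr hp.
  have EB := negbinom_psumS b0 t0 r01 tr hq.
  rewrite pS (negbinom_psum_linear _ _ b1 t0 r0 tr hp hq) in DA EA.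
  rewrite qS (negbinom_psum_linear _ _ b1 t0 r0 tr hq hp) in DB EB.
  move: DA DB EA EB.
  set A1 := negbinom_psum (b + 1) p t; set B1 := negbinom_psum (b + 1) q t.
  move=> DA DB EA EB.
  have n0 : (1 - t * x) ^+ 2 + (t * y) ^+ 2 != 0.
    by rewrite gt_eqF // ltr_pwDl ?exprn_gt0 ?sqr_ge0.
  rewrite -/(A t) in EA; rewrite -/(B t) in EB.
  split.
    apply: is_derive_eq; rewrite -/(u t) -/(v t) EA EB /GRing.scale /=.
    by field.
  apply: is_derive_eq; rewrite -/(u t) -/(v t) EA EB /GRing.scale /=.
  by field.
have := is_derive_eq0_segment (fun t ht => (facts t ht).1).
have := is_derive_eq0_segment (fun t ht => (facts t ht).2).
have -> : A 0 = 1 by rewrite /A negbinom_psum0 /p expr0.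
have -> : B 0 = 0 by rewrite /B negbinom_psum0 /q expr0.
have L0 : L 0 = 0 by rewrite /L !mul0r subr0 oppr0 expr1n expr0n addr0 ln1 mulr0.
have t0 : th 0 = 0 by rewrite /th !mul0r oppr0 mul0r atan0.
have -> : u 0 = 1 by rewrite /u L0 t0 !mulr0 expR0 cos0 mulr1.
have -> : v 0 = 0 by rewrite /v L0 t0 !mulr0 expR0 sin0 mulr0.
have -> : cpow (1 - w) b%:C = u 1 +i* v 1.
  rewrite /cpow clogE; last first.
    rewrite complex_ReD /=.
    have -> : complex.Re (- w) = - x by rewrite /x; case: (w).
    rewrite subr_gt0; apply: le_lt_trans w1.
    exact: le_trans (ler_norm _) (norm_Re_le w).
  rewrite /u /v /L /th /x /y; case: (w) => a c /=.
  by rewrite !mul1r !mul0r sub0r subr0 addr0.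
move=> h1 h2; apply/eqP; rewrite eq_complex /= -/p -/q -/(A 1) -/(B 1) h1 h2.
by rewrite mulr1 !mul0r subr0 !mulr0 addr0 !eqxx.
Qed.

Theorem cvg_negbinom_series (K : realType) (b : K) (w : K[i]) :
  0 < b -> normc w < 1 ->
  series (fun j => (negbinom b j)%:C * w ^+ j) @ \oo -->
    (cpow (1 - w) b%:C)^-1.
Proof.
move=> b0 w1.
have h := negbinom_psum_complex b0 w1.
have -> : (cpow (1 - w) b%:C)^-1 =
  negbinom_psum b (fun j => complex.Re (w ^+ j)) 1
   +i* negbinom_psum b (fun j => complex.Im (w ^+ j)) 1.
  by apply: (mulIf (cpow_neq0 (1 - w) b%:C)); rewrite h mulVf ?cpow_neq0.
have c (p : nat -> K) : (forall j, `|p j| <= normc w ^+ j) ->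
    cvgn (pseries (fun j => negbinom b j * p j) 1).
  by move=> hp; apply: is_cvg_negbinom_pseries hp; rewrite ?normc_ge0 ?mul1r.
apply: cvg_complex.
  have -> : (fun n => complex.Re (series (fun j => (negbinom b j)%:C * w ^+ j) n)) =
      pseries (fun j => negbinom b j * complex.Re (w ^+ j)) 1.
    apply/funext => n; rewrite /series /= complex_Re_sum; apply: eq_bigr => j _.
    by rewrite complex_ReM /= mul0r subr0 expr1n mulr1.
  by apply: c => j; rewrite -normcX norm_Re_le.
have -> : (fun n => complex.Im (series (fun j => (negbinom b j)%:C * w ^+ j) n)) =
    pseries (fun j => negbinom b j * complex.Im (w ^+ j)) 1.
  apply/funext => n; rewrite /series /= complex_Im_sum; apply: eq_bigr => j _.
  by rewrite complex_ImM /= mul0r addr0 expr1n mulr1.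
by apply: c => j; rewrite -normcX norm_Im_le.
Qed.

(** * The generating function *)

Lemma negbinom_complex (K : realType) (b : K) n :
  negbinom b%:C n = (negbinom b n)%:C.
Proof.
rewrite /negbinom /poch rmorphM fmorphV rmorph_nat rmorph_prod; congr (_ / _).
by apply: eq_bigr => i _; rewrite rmorphD rmorph_nat.
Qed.

(** The first i terms vanish; the others form the binomial series with exponent
    b + i. *)
Lemma cvg_negbinom_series_binomial (K : realType) (b : K) (y : K[i]) (i : nat) :
  0 < b -> normc y < 1 ->
  series (fun j => negbinom b%:C j * y ^+ j * 'C(j, i)%:R) @ \oo -->
    negbinom b%:C i * y ^+ i / cpow (1 - y) (b + i%:R)%:C.
Proof.
move=> b0 y1; rewrite -(cvg_shiftn i).
have bi0 : 0 < b + i%:R by rewrite ltr_pwDl.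
have -> : [sequence series (fun j => negbinom b%:C j * y ^+ j * 'C(j, i)%:R)
             (n + i)%N]_n =
   (fun n => negbinom b%:C i * y ^+ i *
      series (fun j => (negbinom (b + i%:R) j)%:C * y ^+ j) n).
  apply/funext => n; rewrite /series /= mulr_sumr.
  rewrite (big_cat_nat _ (n := i)) //=; last exact: leq_addl.
  rewrite big_nat_cond big1 ?add0r; last first.
    by move=> j /andP[/andP[_ ji] _]; rewrite bin_small // mulr0.
  rewrite -{1}(add0n i) big_addn addnK; apply: eq_bigr => j _.
  have := negbinom_shift b%:C i j; rewrite addnC => E.
  transitivity (negbinom b%:C (j + i) * 'C(j + i, i)%:R * (y ^+ j * y ^+ i)).
    by rewrite -exprD; ring.
  rewrite E -negbinom_complex rmorphD rmorph_nat; ring.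
by apply: cvgMr; exact: cvg_negbinom_series.
Qed.

Lemma cvg_sum_nat (K : realType) (I : Type) (r : seq I)
    (f : I -> nat -> K[i]) (l : I -> K[i]) :
  (forall i, f i @ \oo --> l i) ->
  (fun n => \sum_(i <- r) f i n) @ \oo --> \sum_(i <- r) l i.
Proof.
move=> h; apply: cvg_big => //; exact: add_continuous.
Qed.

(** Expanding A_j^2 in the binomials C(j, i) reduces the sum to finitely many
    shifted binomial series; the powers (1 - y)^(- b - i) are brought to the
    common denominator (1 - y)^(b + 2 m), as i <= 2 m. *)
Lemma cvg_meixner_series (K : realType) (m : nat) (b : K) (tau y : K[i]) :
  0 < b -> normc y < 1 ->
  series (fun j => negbinom b%:C j * y ^+ j * meixner m b%:C tau j ^+ 2)
    @ \oo --> diag_sum m b%:C tau y / (cpow (1 - y) b%:C * (1 - y) ^+ (2 * m)).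
Proof.
move=> b0 y1.
have y0 : 1 - y != 0.
  rewrite subr_eq0; apply: contraTneq y1 => <-; by rewrite normc1 ltxx.
have -> : series (fun j => negbinom b%:C j * y ^+ j * meixner m b%:C tau j ^+ 2) =
  (fun n => \sum_(k < m.+1) \sum_(l < m.+1) \sum_(r < k.+1)
    meixner_coef m b%:C tau k * meixner_coef m b%:C tau l *
    ('C(l + r, k) * 'C(k, r))%:R *
    series (fun j => negbinom b%:C j * y ^+ j * 'C(j, l + r)%:R) n).
  apply/funext => n; rewrite /series /=.
  under eq_bigr do rewrite meixner_sqr mulr_sumr.
  rewrite exchange_big /=; apply: eq_bigr => k _.
  under eq_bigr do rewrite mulr_sumr.
  rewrite exchange_big /=; apply: eq_bigr => l _.
  under eq_bigr do rewrite mulr_sumr.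
  rewrite exchange_big /=; apply: eq_bigr => r _.
  by rewrite mulr_sumr; apply: eq_bigr => j _; ring.
rewrite -linearized_sumE // /linearized_sum mulr_suml.
apply: cvg_sum_nat => k; rewrite mulr_suml.
apply: cvg_sum_nat => l; rewrite mulr_suml.
apply: cvg_sum_nat => r; rewrite -[in X in _ --> X]mulrA; apply: cvgMr.
have lr : (l + r <= 2 * m)%N.
  by have := ltn_ord l; have := ltn_ord r; have := ltn_ord k; lia.
have -> : negbinom b%:C (l + r) * y ^+ (l + r) * (1 - y) ^+ (2 * m - (l + r)) /
  (cpow (1 - y) b%:C * (1 - y) ^+ (2 * m)) =
  negbinom b%:C (l + r) * y ^+ (l + r) / cpow (1 - y) (b + (l + r)%:R)%:C.
  rewrite cpowDn // -[in (1 - y) ^+ (2 * m)](subnK lr) [(1 - y) ^+ (_ + _)]exprD; field.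
  by rewrite cpow_neq0 !expf_neq0.
exact: cvg_negbinom_series_binomial.
Qed.

Lemma Gamma_poch (K : realType) (b : K) n : 1 <= b ->
  Gamma (b + n%:R) = poch b n * Gamma b.
Proof.
move=> b1; elim: n => [|n IH]; first by rewrite addr0 poch0 mul1r.
by rewrite -natr1 addrA GammaS ?IH ?pochS ?ler_wpDr //; ring.
Qed.

(** As Gamma (b + n) = (b)_n Gamma b, the Gamma factors reduce to rising
    factorials.  For j < m, expressing the Jacobi polynomial of degree j through
    A_j divides by the square of (j! / m!) ((b)_m / (b)_j) tau^(m - j), which turns
    the coefficient and the power of tau of that case into those of j >= m.  Both
    sides are multiplied by tau^m to avoid negative powers. *)
Lemma gnbd_meixner (K : realType) (nu : K) (z : K[i]) (m : nat) (R : K) (j : nat) :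
  let b := 2 * nu * R ^+ 2 - 2 * m%:R in
  let tau := normc z ^+ 2 / R ^+ 2 in
  1 <= b ->
  negbinom b m * tau ^+ m * gnbd nu z m R j =
  (1 - tau) `^ b * (negbinom b j * tau ^+ j * meixner m b tau j ^+ 2).
Proof.
move=> b tau b1; have b0 : 0 < b by apply: lt_le_trans b1.
have G0 : Gamma b != 0 by rewrite gt_eqF // Gamma_gt0.
have p0 (c : K) n : 0 < c -> poch c n != 0 by move=> c0; rewrite gt_eqF // poch_gt0.
rewrite /gnbd /gnbd_coef -/b -/tau.
have -> : 2 * nu * R ^+ 2 - m%:R = b + m%:R by rewrite /b; ring.
clearbody b tau; rewrite !Gamma_poch //; case: leqP => jm.
  rewrite distnEl // (meixner_jacobi_le _ _ jm).
  have -> : poch b m = poch b j * poch (b + j%:R) (m - j) by rewrite -pochD subnKC.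
  set J := jacobi _ _ _ _.
  rewrite /negbinom.
  have -> : poch b m = poch b j * poch (b + j%:R) (m - j) by rewrite -pochD subnKC.
  rewrite -[in tau ^+ m](subnK jm) exprD !exprMn -[((- tau) ^+ _) ^+ 2]exprM.
  have -> : (- tau) ^+ ((m - j) * 2) = tau ^+ (m - j) * tau ^+ (m - j).
    by rewrite mulnC exprM sqrrN -exprM mul2n -addnn exprD.
  by field; rewrite G0 (p0 _ _ b0) (fact_neq0 _ m) (fact_neq0 _ j).
rewrite (distnEr (ltnW jm)) (meixner_jacobi_ge _ _ (ltnW jm)).
rewrite /negbinom -[in tau ^+ j](subnK (ltnW jm)) exprD.
field; by rewrite G0 (p0 _ _ b0) (fact_neq0 _ m) (fact_neq0 _ j).
Qed.

(** Only j = m keeps the power 0^0, and a Jacobi polynomial with first parameter 0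
    is 1 at the point 1. *)
Lemma gnbd_tau0 (K : realType) (nu : K) (z : K[i]) (m : nat) (R : K) (j : nat) :
  1 <= 2 * nu * R ^+ 2 - 2 * m%:R -> normc z ^+ 2 / R ^+ 2 = 0 ->
  gnbd nu z m R j = (j == m)%:R.
Proof.
move=> b1 t0; rewrite /gnbd t0 subr0 powR1 mulr1.
case: eqP => [->|jm]; last first.
  rewrite expr0n (_ : (_ == _) = false) ?mulr0 ?mul0r //.
  by apply/negbTE; rewrite absz_eq0 subr_eq0 eqz_nat eq_sym; apply/eqP.
rewrite subrr absz0 expr0 mulr1 minnn mulr0 subr0.
set b := 2 * nu * R ^+ 2 - 2 * m%:R in b1 *.
have b0 : 0 < b by apply: lt_le_trans b1.
rewrite /gnbd_coef leqnn -/b.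
have -> : 2 * nu * R ^+ 2 - m%:R = b + m%:R by rewrite /b; ring.
rewrite divff ?mul1r; last first.
  rewrite Gamma_poch // !mulf_neq0 ?(fact_neq0 K m) //.
    by rewrite gt_eqF // poch_gt0.
  by rewrite gt_eqF // Gamma_gt0.
have := jacobi_negbinom m 0 b 0; rewrite mulr0 subr0 => ->.
rewrite big_ord_recr /= big1 => [|k _].
  by rewrite add0r addn0 binn subnn negbinom0 !expr0 expr1n !mulr1 expr1n.
by rewrite oppr0 expr0n subn_eq0 leqNgt ltn_ord mulr0 mul0r.
Qed.

Lemma meixner_complex (K : realType) (m : nat) (b tau : K) (j : nat) :
  (meixner m b tau j)%:C = meixner m b%:C tau%:C j.
Proof.
rewrite /meixner rmorph_sum /=; apply: eq_bigr => k _.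
have -> : b%:C + k%:R = (b + k%:R)%:C by rewrite rmorphD rmorph_nat.
by rewrite negbinom_complex !rmorphM !rmorphXn rmorphN rmorphB rmorph1 rmorph_nat.
Qed.

Lemma cpow1 (K : realType) (s : K[i]) : cpow 1 s = 1.
Proof.
rewrite /cpow; have -> : clog (1 : K[i]) = 0.
  by rewrite clogE //= expr1n expr0n addr0 ln1 mulr0 mul0r atan0.
by rewrite mulr0 cexp0.
Qed.

Lemma normc_real (K : realType) (x : K) : 0 <= x -> normc x%:C = x.
Proof. by move=> x0; rewrite /normc /= expr0n addr0 sqrtr_sqr ger0_norm. Qed.

(* Q is the polynomial expression in the variable formed by the m-th power and
   the Jacobi polynomial; its value is used also where the argument of the
   Jacobi polynomial is singular. *)
Theorem proposition1 (K : realType) (R nu : K) (m : nat) (z : K[i])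
    (hR : 0 < R) (hnu : 1 / (2 * R ^+ 2) < nu)
    (hm : m%:Z <= Num.floor (nu * R ^+ 2 - 1 / 2))
    (hz : normc z < R) :
  let tau : K[i] := (normc z ^+ 2 / R ^+ 2)%:C in
  let B : K[i] := (2 * nu * R ^+ 2)%:C in
  exists Q : {poly K[i]},
    (forall zeta : K[i], (tau - zeta) * (1 - tau * zeta) != 0 ->
       Q.[zeta] =
         ((tau - zeta) * (1 - tau * zeta) / (1 - tau) ^+ 2) ^+ m
         * jacobi m (B - 2 * m%:R - 1) 0
             (1 + 2 * zeta * (1 - tau) ^+ 2
                  / ((tau - zeta) * (1 - tau * zeta))))
    /\
    (forall xi : K[i], normc xi < 1 ->
       series (fun j : nat => xi ^+ j * (gnbd nu z m R j)%:C) @ \oo -->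
         cpow ((1 - tau) / (1 - tau * xi)) B * Q.[xi]).
Proof.
move=> tau B.
pose t := normc z ^+ 2 / R ^+ 2; pose b := 2 * nu * R ^+ 2 - 2 * m%:R.
have b1 : 1 <= b.
  move: hm; rewrite floor_ge_int // => h; rewrite /b.
  have {}h : m%:R <= nu * R ^+ 2 - 1 / 2 by [].
  lra.
have b0 : 0 < b by apply: lt_le_trans b1.
have t0 : 0 <= t by rewrite divr_ge0 ?sqr_ge0.
have t1 : 0 < 1 - t.
  rewrite subr_gt0 ltr_pdivrMr ?exprn_gt0 // mul1r ltr_pXn2r ?nnegrE ?normc_ge0 //.
  exact: ltW.
have tauE : 1 - tau = (1 - t)%:C by rewrite rmorphB rmorph1.
have tau1 : 1 - tau != 0.
  by rewrite tauE eq_complex /= eqxx andbT gt_eqF.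
have BE : B - 2 * m%:R = b%:C.
  by rewrite /b rmorphB; congr (_ - _); rewrite rmorphM !rmorph_nat.
exists (jacobi_factor m (B - 2 * m%:R - 1) tau); split=> [zeta|xi xi1].
  exact: jacobi_factorE.
rewrite BE.
have [tz|tn0] := eqVneq t 0.
  have tau0 : tau = 0 by rewrite /tau -/t tz.
  have -> : (jacobi_factor m (b%:C - 1) tau).[xi] = xi ^+ m.
    rewrite horner_jacobi_factor tau0 big_ord_recl /= big1 ?addr0 => [|k _].
      rewrite !subn0 binn subr0 !expr1n /gbinom big_ord0 fact0.
      by rewrite !expr0 !divr1 !mulr1 mul1r.
    by rewrite mul0r expr0n mulr0.
  rewrite tau0 mul0r subr0 divr1 cpow1 mul1r.
  (* All terms but the one of index m vanish. *)
  rewrite -(cvg_shiftn m.+1).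
  have -> : [sequence series (fun j => xi ^+ j * (gnbd nu z m R j)%:C) (n + m.+1)%N]_n
      = cst (xi ^+ m).
    apply/funext => n; rewrite /series /= (bigD1_seq m) /= ?iota_uniq //; last first.
      by rewrite mem_index_iota /= ltn_addl.
    rewrite gnbd_tau0 // eqxx mulr1 big1 ?addr0 // => j /negbTE jm.
    by rewrite gnbd_tau0 // jm mulr0.
  exact: cvg_cst.
have tau0 : tau != 0 by rewrite /tau -/t eq_complex /= eqxx andbT.
pose y := tau * xi.
have y1 : normc y < 1.
  rewrite /y normcM normc_real //; apply: le_lt_trans xi1.
  by rewrite ler_piMl ?normc_ge0 // -subr_ge0 ltW.
have Rey : 0 < complex.Re (1 - y).
  rewrite complex_ReD /=; have -> : complex.Re (- y) = - complex.Re y by case: (y).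
  rewrite subr_gt0; apply: le_lt_trans y1.
  exact: le_trans (ler_norm _) (norm_Re_le _).
have y0 : 1 - y != 0 by apply: contraTneq Rey => ->; rewrite /= ltxx.
pose c := negbinom b%:C m * tau ^+ m.
have c0 : c != 0.
  rewrite mulf_neq0 ?expf_neq0 // negbinom_complex eq_complex /= eqxx andbT.
  by rewrite gt_eqF // divr_gt0 ?poch_gt0 // ltr0n fact_gt0.
have -> : series (fun j => xi ^+ j * (gnbd nu z m R j)%:C) =
  (fun n => (((1 - t) `^ b)%:C / c) *
    series (fun j => negbinom b%:C j * y ^+ j * meixner m b%:C tau j ^+ 2) n).
  apply/funext => n; rewrite /series /= mulr_sumr; apply: eq_bigr => j _.
  have E : c * (gnbd nu z m R j)%:C = ((1 - t) `^ b)%:C *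
      (negbinom b%:C j * tau ^+ j * meixner m b%:C tau j ^+ 2).
    rewrite /c !negbinom_complex -meixner_complex /tau -/t -!rmorphXn -!rmorphM.
    by congr (_%:C); exact: gnbd_meixner.
  apply: (mulfI c0); rewrite mulrCA -/c E /y exprMn; field.
  exact: c0.
have -> : cpow ((1 - tau) / (1 - tau * xi)) B * (jacobi_factor m (b%:C - 1) tau).[xi]
  = ((1 - t) `^ b)%:C / c *
    (diag_sum m b%:C tau y / (cpow (1 - y) b%:C * (1 - y) ^+ (2 * m))).
  rewrite diag_sum_jacobi_factor // tauE cpow_div // -/y.
  have -> : (2 * nu * R ^+ 2) = b + (2 * m)%:R by rewrite /b natrM subrK.
  rewrite cpowDn // powRD; last by rewrite (gt_eqF t1) implybT.
  rewrite powR_mulrn ?ltW // rmorphM rmorphXn /= -/c -tauE.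
  field.
  by rewrite c0 cpow_neq0 !expf_neq0.
apply: cvgMr; exact: cvg_meixner_series.
Qed.
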